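(* Every $H$-prime ideal of $K_n$ is generated (as a two-sided ideal) by an admissible set.
   Context: Let $k$ be a field of arbitrary characteristic and $n\ge 1$. All algebras are associative and unital. Let $p_1,\dots,p_n,q_1,\dots,q_n\in k^\times$ with $p_i\ne q_i$ for all $i$, and let $\Gamma=(\gamma_{i,j})\in M_n(k^\times)$ with $\gamma_{j,i}=\gamma_{i,j}^{-1}$ and $\gamma_{i,i}=1$ for all $i,j$. $K_n$ is the $k$-algebra generated by $x_1,y_1,\dots,x_n,y_n$ subject to the relations: $y_iy_j=\gamma_{i,j}y_jy_i$ for all $i,j$; $x_iy_j=p_j\gamma_{j,i}y_jx_i$ for $i<j$; $x_iy_j=q_j\gamma_{j,i}y_jx_i$ for $i>j$; $x_ix_j=q_ip_j^{-1}\gamma_{i,j}x_jx_i$ for $i<j$; $x_iy_i=q_iy_ix_i+\sum_{\ell<i}(q_\ell-p_\ell)y_\ell x_\ell$ for all $i$. Standing assumption: $p_iq_i^{-1}$ is not a root of unity for each $i\in\{1,\dots,n\}$. Group action: $H=\{(h_1,\dots,h_{2n})\in(k^\times)^{2n}\mid h_{2i-1}h_{2i}=h_{2j-1}h_{2j}\ \text{for all } i,j=1,\dots,n\}$ acts on $K_n$ by $k$-algebra automorphisms via $h(x_i)=h_{2i-1}x_i$, $h(y_i)=h_{2i}y_i$. An ideal $I$ is $H$-stable if $h(I)=I$ for all $h\in H$. A proper $H$-stable ideal $Q$ is $H$-prime if whenever $I,J$ are $H$-stable ideals with $IJ\subseteq Q$, either $I\subseteq Q$ or $J\subseteq Q$.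 For $i=1,\dots,n$ set $\Omega_i=\sum_{\ell\le i}(q_\ell-p_\ell)y_\ell x_\ell$, and set $\mathcal{P}_n=\{x_1,\dots,x_n,y_1,\dots,y_n,\Omega_1,\dots,\Omega_n\}$. A subset $T\subseteq\mathcal{P}_n$ is admissible if: (1) for $2\le i\le n$, ($x_i\in T$ or $y_i\in T$) if and only if ($\Omega_i\in T$ and $\Omega_{i-1}\in T$); and (2) ($x_1\in T$ or $y_1\in T$) if and only if $\Omega_1\in T$. *)

(* Defs.v *)
From HB Require Import structures.
From mathcomp Require Import all_boot all_order all_algebra.
From mathcomp Require Import boolp classical_sets.
From mathcomp Require Import generic_quotient ring_quotient.
From mathcomp.multinomials Require Import monalg.

Set Implicit Arguments.
Unset Strict Implicit.
Unset Printing Implicit Defensive.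

Import GRing.Theory.
Local Open Scope classical_set_scope.
Local Open Scope quotient_scope.
Local Open Scope ring_scope.

Section Ideals.
Variable R : nzRingType.
Implicit Types (I J S : set R).

Record is_ideal I : Prop := IsIdeal {
  is_ideal0 : I 0;
  is_idealD : forall a b, I a -> I b -> I (a + b);
  is_idealMl : forall a b, I b -> I (a * b);
  is_idealMr : forall a b, I b -> I (b * a) }.

Definition ideal_gen S : set R := smallest is_ideal S.

Definition ideal_mul I J : set R :=
  [set u | exists s : seq (R * R),
     (forall ab, ab \in s -> I ab.1 /\ J ab.2) /\
     u = \sum_(ab <- s) ab.1 * ab.2].

Lemma ideal_gen_ideal S : is_ideal (ideal_gen S).
Proof.
split.
- by move=> I [hI _]; exact: is_ideal0.
- by move=> a b ha hb I hI; apply: (is_idealD hI.1); [exact: ha|exact: hb].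
- by move=> a b hb I hI; apply: (is_idealMl hI.1); exact: hb.
- by move=> a b hb I hI; apply: (is_idealMr hI.1); exact: hb.
Qed.

Lemma sub_ideal_gen S : S `<=` ideal_gen S.
Proof. exact: sub_gen_smallest. Qed.

End Ideals.

Section AlgebraPresentation.
Variables (k : fieldType) (A : algType k) (S : set A).

Definition quot_ker : {pred A} := fun u => `[< ideal_gen S u >].

Lemma quot_kerP : is_ideal [set u | quot_ker u].
Proof.
have [h0 hD hl hr] := ideal_gen_ideal S.
split=> [|a b /asboolP ha /asboolP hb|a b /asboolP hb|a b /asboolP hb];
  apply/asboolP; [exact: h0|exact: hD|exact: hl|exact: hr].
Qed.

Lemma quot_ker_zmod : zmod_closed quot_ker.
Proof.
split=> [|u v hu hv]; first exact: (is_ideal0 quot_kerP).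
rewrite -[- v]mulN1r.
by apply: (is_idealD quot_kerP hu); apply: (is_idealMl quot_kerP).
Qed.
HB.instance Definition _ := GRing.isZmodClosed.Build A quot_ker quot_ker_zmod.

Hypothesis S_proper : ~ ideal_gen S 1.

(* S_proper is an argument because nzRingType requires 1 != 0. *)
Definition alg_quot of ~ ideal_gen S 1 : Type := @Quotient.quot A quot_ker.
Local Notation Q := (alg_quot S_proper).
HB.instance Definition _ := GRing.Zmodule.on Q.
HB.instance Definition _ := ZmodQuotient.on Q.

Lemma quot_eqP (u v : A) : reflect (\pi_Q u = \pi_Q v) (quot_ker (u - v)).
Proof. by rewrite [quot_ker _](@Quotient.idealrBE A quot_ker); exact: eqP. Qed.

Definition quot_one : Q := lift_cst Q 1.
Definition quot_mul : Q -> Q -> Q := lift_op2 Q *%R.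
Definition quot_scale (c : k) : Q -> Q := lift_op1 Q ( *:%R c).

Lemma quot_reprP (u : A) : quot_ker (repr (\pi_Q u) - u).
Proof. by apply/quot_eqP; rewrite reprK. Qed.

Lemma quot_piD : {morph \pi_Q : u v / u + v}.
Proof. by move=> u v; rewrite piE. Qed.

Lemma quot_pi1 : \pi_Q 1 = quot_one.
Proof. by rewrite /quot_one -lock. Qed.

Lemma quot_piM u v : \pi_Q (u * v) = quot_mul (\pi_Q u) (\pi_Q v).
Proof.
rewrite /quot_mul -lock; apply/esym/quot_eqP; set u' := repr _; set v' := repr _.
have -> : u' * v' - u * v = (u' - u) * v' + u * (v' - v).
  by rewrite mulrBl mulrBr addrA subrK.
apply: (is_idealD quot_kerP).
  by apply: (is_idealMr quot_kerP); exact: quot_reprP.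
by apply: (is_idealMl quot_kerP); exact: quot_reprP.
Qed.

Lemma quot_piZ c u : \pi_Q (c *: u) = quot_scale c (\pi_Q u).
Proof.
rewrite /quot_scale -lock; apply/esym/quot_eqP.
rewrite -scalerBr -[_ - _]mul1r scalerAl.
by apply: (is_idealMl quot_kerP); exact: quot_reprP.
Qed.

Lemma quot_ind (P : Q -> Prop) : (forall u, P (\pi_Q u)) -> forall a, P a.
Proof. by move=> h a; rewrite -[a]reprK. Qed.

Lemma quot_mulA : associative quot_mul.
Proof.
by elim/quot_ind=> u; elim/quot_ind=> v; elim/quot_ind=> w;
  rewrite -!quot_piM mulrA.
Qed.
Lemma quot_mul1l : left_id quot_one quot_mul.
Proof. by elim/quot_ind=> u; rewrite -quot_pi1 -quot_piM mul1r. Qed.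
Lemma quot_mul1r : right_id quot_one quot_mul.
Proof. by elim/quot_ind=> u; rewrite -quot_pi1 -quot_piM mulr1. Qed.
Lemma quot_mulDl : left_distributive quot_mul +%R.
Proof.
elim/quot_ind=> u; elim/quot_ind=> v; elim/quot_ind=> w.
by rewrite -!quot_piM -!quot_piD -quot_piM mulrDl.
Qed.
Lemma quot_mulDr : right_distributive quot_mul +%R.
Proof.
elim/quot_ind=> u; elim/quot_ind=> v; elim/quot_ind=> w.
by rewrite -!quot_piM -!quot_piD -quot_piM mulrDr.
Qed.
Lemma quot_one_neq0 : quot_one != 0.
Proof.
have -> : (0 : Q) = \pi_Q 0 by rewrite piE.
by rewrite -quot_pi1; apply/eqP => /quot_eqP; rewrite subr0 => /asboolP.
Qed.
HB.instance Definition _ := GRing.Zmodule_isNzRing.Build Q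
  quot_mulA quot_mul1l quot_mul1r quot_mulDl quot_mulDr quot_one_neq0.

Lemma quot_scaleA c d a : quot_scale c (quot_scale d a) = quot_scale (c * d) a.
Proof. by elim/quot_ind: a => u; rewrite -!quot_piZ scalerA. Qed.
Lemma quot_scale1 : left_id 1 quot_scale.
Proof. by elim/quot_ind=> u; rewrite -quot_piZ scale1r. Qed.
Lemma quot_scaleDr : right_distributive quot_scale +%R.
Proof.
move=> c; elim/quot_ind=> u; elim/quot_ind=> v.
by rewrite -!quot_piZ -!quot_piD -quot_piZ scalerDr.
Qed.
Lemma quot_scaleDl a : {morph quot_scale^~ a : c d / c + d}.
Proof.
by move=> c d; elim/quot_ind: a => u; rewrite -!quot_piZ -quot_piD scalerDl.
Qed.
HB.instance Definition _ := GRing.Zmodule_isLmodule.Build k Q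
  quot_scaleA quot_scale1 quot_scaleDr quot_scaleDl.

Lemma quot_scaleAl (c : k) (a b : Q) : c *: (a * b) = (c *: a) * b.
Proof.
elim/quot_ind: a => u; elim/quot_ind: b => v.
change (quot_scale c (quot_mul (\pi_Q u) (\pi_Q v)) =
        quot_mul (quot_scale c (\pi_Q u)) (\pi_Q v)).
by rewrite -quot_piM -!quot_piZ -quot_piM scalerAl.
Qed.
HB.instance Definition _ := GRing.Lmodule_isLalgebra.Build k Q quot_scaleAl.

Lemma quot_scaleAr (c : k) (a b : Q) : c *: (a * b) = a * (c *: b).
Proof.
elim/quot_ind: a => u; elim/quot_ind: b => v.
change (quot_scale c (quot_mul (\pi_Q u) (\pi_Q v)) =
        quot_mul (\pi_Q u) (quot_scale c (\pi_Q v))).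
by rewrite -quot_piM -!quot_piZ -quot_piM scalerAr.
Qed.
HB.instance Definition _ := GRing.Lalgebra_isAlgebra.Build k Q quot_scaleAr.

Definition quot_pi (u : A) : Q := \pi_Q u.

Lemma quot_pi_zmod : zmod_morphism quot_pi.
Proof. by move=> u v; rewrite /quot_pi piE. Qed.
HB.instance Definition _ := GRing.isZmodMorphism.Build A Q quot_pi quot_pi_zmod.
Lemma quot_pi_monoid : monoid_morphism quot_pi.
Proof. by split=> [|u v]; [exact: quot_pi1|exact: quot_piM]. Qed.
HB.instance Definition _ :=
  GRing.isMonoidMorphism.Build A Q quot_pi quot_pi_monoid.
Lemma quot_pi_scalable : scalable quot_pi.
Proof. by move=> c u; exact: quot_piZ. Qed.
HB.instance Definition _ :=
  GRing.isScalable.Build k A Q *:%R quot_pi quot_pi_scalable.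

Lemma quot_pi_surj (a : Q) : exists u, a = quot_pi u.
Proof. by exists (repr a); rewrite /quot_pi reprK. Qed.

Lemma quot_piP (u v : A) : quot_pi u = quot_pi v <-> ideal_gen S (u - v).
Proof.
by split=> [/quot_eqP/asboolP//|h]; apply/quot_eqP; apply/asboolP.
Qed.

Lemma quot_pi_rel (u : A) : S u -> quot_pi u = 0.
Proof.
move=> hu; rewrite -(raddf0 quot_pi); apply/quot_piP.
by rewrite subr0; exact: sub_ideal_gen.
Qed.

End AlgebraPresentation.

Lemma ideal_gen_morph (k : fieldType) (A B : algType k) (S : set A)
    (phi : {lrmorphism A -> B}) :
  (forall u, S u -> phi u = 0) -> forall u, ideal_gen S u -> phi u = 0.
Proof.
move=> hS u; apply: (smallest_sub (X := [set u | phi u = 0])) => //.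
split=> /= [|a b ha hb|a b hb|a b hb].
- exact: raddf0.
- by rewrite raddfD /= ha hb addr0.
- by rewrite rmorphM /= hb mulr0.
- by rewrite rmorphM /= hb mul0r.
Qed.

Section QuotientLift.
Variables (k : fieldType) (A B : algType k) (S : set A).
Variable S_proper : ~ ideal_gen S 1.
Variable phi : {lrmorphism A -> B}.
Local Notation Q := (alg_quot S_proper).
Local Notation pi := (quot_pi S_proper).

Definition quot_lift of (forall u, S u -> phi u = 0) : Q -> B :=
  fun a => phi (repr a).

Hypothesis phiS : forall u, S u -> phi u = 0.
Local Notation lift := (quot_lift phiS).

Lemma quot_liftE u : lift (pi u) = phi u.
Proof.
apply/eqP; rewrite -subr_eq0 -(raddfB phi); apply/eqP.
apply: (ideal_gen_morph phiS); apply/(quot_piP S_proper).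
by rewrite /quot_pi reprK.
Qed.

Lemma quot_lift_zmod : zmod_morphism lift.
Proof.
move=> a b; have [u ->] := quot_pi_surj a; have [v ->] := quot_pi_surj b.
by rewrite -(raddfB pi) !quot_liftE raddfB.
Qed.
HB.instance Definition _ := GRing.isZmodMorphism.Build Q B lift quot_lift_zmod.
Lemma quot_lift_monoid : monoid_morphism lift.
Proof.
split=> [|a b]; first by rewrite -(rmorph1 pi) quot_liftE rmorph1.
have [u ->] := quot_pi_surj a; have [v ->] := quot_pi_surj b.
by rewrite -(rmorphM pi) !quot_liftE rmorphM.
Qed.
HB.instance Definition _ :=
  GRing.isMonoidMorphism.Build Q B lift quot_lift_monoid.
Lemma quot_lift_scalable : scalable lift.
Proof.
move=> c a; have [u ->] := quot_pi_surj a.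
by rewrite -(linearZ_LR pi) !quot_liftE linearZ.
Qed.
HB.instance Definition _ :=
  GRing.isScalable.Build k Q B *:%R lift quot_lift_scalable.

End QuotientLift.

Lemma malg_scaleAr (k : fieldType) (M : monomType) (c : k)
  (u v : {malg k[M]}) : c *: (u * v) = u * (c *: v).
Proof.
have comm : u * c%:MP = c *: u.
  rewrite malgM_def malgZ_def fgmulgU.
  by apply: eq_bigr => m _; rewrite mulm1 mulrC.
by rewrite -(mul_malgC c v) mulrA comm scalerAl.
Qed.

Section WordAlgebra.
Variables (k : fieldType) (G : choiceType).

Definition word_alg : Type := {malg k[{fmonom G}]}.
HB.instance Definition _ := GRing.Lalgebra.on word_alg.

Lemma word_scaleAr (c : k) (u v : word_alg) : c *: (u * v) = u * (c *: v).
Proof. exact: malg_scaleAr. Qed.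
HB.instance Definition _ := GRing.Lalgebra_isAlgebra.Build k word_alg word_scaleAr.

Definition word_gen (g : G) : word_alg := << fmu g >>.

Variables (B : algType k) (f : G -> B).

Definition mon_eval (m : {fmonom G}) : B := \prod_(g <- m) f g.

Lemma mon_evalP : mmorphism mon_eval.
Proof.
split=> [m1 m2|]; first by rewrite /mon_eval fmM big_cat.
by rewrite /mon_eval fm1 big_nil.
Qed.
HB.instance Definition _ :=
  isMultiplicative.Build {fmonom G} B mon_eval mon_evalP.

Definition word_eval (u : word_alg) : B := mmap (in_alg B) mon_eval u.
Arguments word_eval : simpl never.

Lemma word_eval_zmod : zmod_morphism word_eval.
Proof. exact: (@mmap_is_additive _ _ _ (in_alg B) mon_eval). Qed.
HB.instance Definition _ :=
  GRing.isZmodMorphism.Build word_alg B word_eval word_eval_zmod.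

Lemma word_eval_monoid : monoid_morphism word_eval.
Proof.
have [] := @commr_mmap_is_multiplicative _ _ _ (in_alg B) mon_eval.
  move=> u m m'; rewrite /GRing.comm /= -scalerAl -scalerAr.
  by rewrite mul1r mulr1.
by move=> hM h1; split.
Qed.
HB.instance Definition _ :=
  GRing.isMonoidMorphism.Build word_alg B word_eval word_eval_monoid.

Lemma word_eval_scalable : scalable word_eval.
Proof.
move=> c u; rewrite /word_eval (@mmapZ _ _ _ (in_alg B) mon_eval) /=.
by rewrite -scalerAl mul1r.
Qed.
HB.instance Definition _ :=
  GRing.isScalable.Build k word_alg B *:%R word_eval word_eval_scalable.

Lemma word_evalU g : word_eval (word_gen g) = f g.
Proof.
rewrite /word_eval (@mmapU _ _ _ (in_alg B)) /mon_eval fmU big_seq1.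
by rewrite /= scale1r mul1r.
Qed.

End WordAlgebra.

Lemma word_evalE (k : fieldType) (G : choiceType) (B : algType k)
    (phi : {lrmorphism word_alg k G -> B}) :
  phi =1 word_eval (fun g => phi (word_gen k g)).
Proof.
move=> u; rewrite [in LHS](monalgE u) (raddf_sum phi) /word_eval mmapE /=.
apply: eq_bigr => m _.
have -> : << u@_m *g m >> = u@_m *: (<< m >> : {malg k[{fmonom G}]}).
  by apply/malgP => m'; rewrite mcoeffZ !mcoeffU mulr_natr.
rewrite (linearZ_LR phi) /= -scalerAl mul1r; congr (_ *: _).
case: m => m; elim: m => [|g m IH].
  by rewrite /mon_eval /= big_nil -(rmorph1 phi) -[FMonom _]fmoneE.
have -> : << FMonom (g :: m) >> =
    word_gen k g * (<< FMonom m >> : word_alg k G).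
  rewrite malgM_def fgmulUU mulr1; congr << 1 *g _ >>.
  by rewrite [RHS]fmmulE fmuE.
by rewrite (rmorphM phi) /= IH /mon_eval /= big_cons.
Qed.

Section AlgebraCast.
Variables (k : fieldType) (A B : algType k) (AB : A = B).

Definition alg_cast : A -> B :=
  fun u => eq_rect A (fun C : algType k => C : Type) u B AB.

Lemma alg_cast_zmod : zmod_morphism alg_cast.
Proof. by rewrite /alg_cast; case: B / AB. Qed.
HB.instance Definition _ := GRing.isZmodMorphism.Build A B alg_cast alg_cast_zmod.
Lemma alg_cast_monoid : monoid_morphism alg_cast.
Proof. by rewrite /alg_cast; case: B / AB. Qed.
HB.instance Definition _ :=
  GRing.isMonoidMorphism.Build A B alg_cast alg_cast_monoid.
Lemma alg_cast_scalable : scalable alg_cast.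
Proof. by rewrite /alg_cast; case: B / AB. Qed.
HB.instance Definition _ :=
  GRing.isScalable.Build k A B *:%R alg_cast alg_cast_scalable.

End AlgebraCast.

Lemma alg_castK (k : fieldType) (A B : algType k) (AB : A = B) :
  cancel (alg_cast AB) (alg_cast (esym AB)).
Proof. by case: B / AB. Qed.

Lemma alg_castVK (k : fieldType) (A B : algType k) (AB : A = B) :
  cancel (alg_cast (esym AB)) (alg_cast AB).
Proof. by case: B / AB. Qed.

(* Working directly in word_alg makes unification between algebra structures
   extremely slow, hence the lock. *)
Section FreeAlgebra.
Variables (k : fieldType) (G : choiceType).

Definition free_alg : algType k := locked (word_alg k G : algType k).

Definition free_of_word : word_alg k G -> free_alg :=
  alg_cast (lock (word_alg k G : algType k)).
HB.instance Definition _ := GRing.LRMorphism.on free_of_word.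

Definition word_of_free : free_alg -> word_alg k G :=
  alg_cast (esym (lock (word_alg k G : algType k))).
HB.instance Definition _ := GRing.LRMorphism.on word_of_free.

Lemma free_of_wordK : cancel free_of_word word_of_free.
Proof. exact: alg_castK. Qed.

Lemma word_of_freeK : cancel word_of_free free_of_word.
Proof. exact: alg_castVK. Qed.

Definition free_gen (g : G) : free_alg := free_of_word (word_gen k g).

Definition free_eval (B : algType k) (f : G -> B) : free_alg -> B :=
  word_eval f \o word_of_free.
HB.instance Definition _ B f := GRing.LRMorphism.on (@free_eval B f).

Lemma free_evalU (B : algType k) (f : G -> B) g : free_eval f (free_gen g) = f g.
Proof. by rewrite /free_eval /= free_of_wordK word_evalU. Qed.

Lemma free_evalE (B : algType k) (phi : {lrmorphism free_alg -> B}) :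
  phi =1 free_eval (fun g => phi (free_gen g)).
Proof.
move=> u; rewrite -[in LHS](word_of_freeK u).
exact: (word_evalE (phi \o free_of_word)).
Qed.

End FreeAlgebra.

Section Relations.
Variables (k : fieldType) (n : nat) (p q : 'I_n -> k) (gam : 'M[k]_n).

Inductive Kn_rel (A : algType k) (x y : 'I_n -> A) : set A :=
| Krel_yy (i j : 'I_n) :
    Kn_rel x y (y i * y j - gam i j *: (y j * y i))
| Krel_xy_lt (i j : 'I_n) : (i < j)%N ->
    Kn_rel x y (x i * y j - (p j * gam j i) *: (y j * x i))
| Krel_xy_gt (i j : 'I_n) : (i > j)%N ->
    Kn_rel x y (x i * y j - (q j * gam j i) *: (y j * x i))
| Krel_xx_lt (i j : 'I_n) : (i < j)%N ->
    Kn_rel x y (x i * x j - (q i * (p j)^-1 * gam i j) *: (x j * x i))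
| Krel_xy (i : 'I_n) :
    Kn_rel x y (x i * y i - (q i *: (y i * x i)
                  + \sum_(l < n | (l < i)%N) (q l - p l) *: (y l * x l))).

Lemma Kn_rel_morph (A B : algType k) (phi : {lrmorphism A -> B}) x y u :
  Kn_rel x y u -> Kn_rel (phi \o x) (phi \o y) (phi u).
Proof.
have hq a b c d e : phi (a * b - c *: (d * e)) =
    phi a * phi b - c *: (phi d * phi e).
  by rewrite (raddfB phi) /= (linearZ_LR phi) /= !(rmorphM phi).
case=> [i j|i j ij|i j ij|i j ij|i]; rewrite ?hq.
- exact: Krel_yy.
- exact: Krel_xy_lt.
- exact: Krel_xy_gt.
- exact: Krel_xx_lt.
rewrite (raddfB phi) /= (raddfD phi) /= (raddf_sum phi) /= (linearZ_LR phi) /=.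
under eq_bigr => l _ do rewrite (linearZ_LR phi) /= (rmorphM phi).
by rewrite !(rmorphM phi); exact: (@Krel_xy B (phi \o x) (phi \o y) i).
Qed.

Lemma Kn_rel_morphV (A B : algType k) (phi : {lrmorphism A -> B}) x y v :
  Kn_rel (phi \o x) (phi \o y) v -> exists u, Kn_rel x y u /\ v = phi u.
Proof.
have hq a b c d e : phi (a * b - c *: (d * e)) =
    phi a * phi b - c *: (phi d * phi e).
  by rewrite (raddfB phi) /= (linearZ_LR phi) /= !(rmorphM phi).
case=> [i j|i j ij|i j ij|i j ij|i].
- by eexists; split; [exact: Krel_yy i j|rewrite hq].
- by eexists; split; [exact: Krel_xy_lt ij|rewrite hq].
- by eexists; split; [exact: Krel_xy_gt ij|rewrite hq].
- by eexists; split; [exact: Krel_xx_lt ij|rewrite hq].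
eexists; split; first exact: Krel_xy i.
rewrite (raddfB phi) /= (raddfD phi) /= (raddf_sum phi) /= (linearZ_LR phi) /=.
rewrite !(rmorphM phi); congr (_ - (_ + _)); apply: eq_bigr => l _.
by rewrite (linearZ_LR phi) /= (rmorphM phi).
Qed.

Lemma Kn_rel_scale (A : algType k) (x y : 'I_n -> A) (a b : 'I_n -> k) u :
  (forall i j, a i * b i = a j * b j) ->
  Kn_rel (fun i => a i *: x i) (fun i => b i *: y i) u ->
  exists c v, Kn_rel x y v /\ u = c *: v.
Proof.
move=> hab; have sc c d (v w : A) : (c *: v) * (d *: w) = (c * d) *: (v * w).
  by rewrite -scalerAl -scalerAr scalerA.
case=> [i j|i j ij|i j ij|i j ij|i]; rewrite ?sc.
- exists (b i * b j); eexists; split; first exact: Krel_yy i j.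
  by rewrite scalerBr !scalerA mulrC [b j * _]mulrC [gam i j * _]mulrC.
- exists (a i * b j); eexists; split; first exact: Krel_xy_lt ij.
  by rewrite scalerBr !scalerA [b j * _]mulrC [p j * _ * _]mulrC.
- exists (a i * b j); eexists; split; first exact: Krel_xy_gt ij.
  by rewrite scalerBr !scalerA [b j * _]mulrC [q j * _ * _]mulrC.
- exists (a i * a j); eexists; split; first exact: Krel_xx_lt ij.
  by rewrite scalerBr !scalerA [a j * _]mulrC [q i / _ * _ * _]mulrC.
exists (a i * b i); eexists; split; first exact: Krel_xy i.
rewrite scalerBr scalerDr scaler_sumr !scalerA [b i * _]mulrC [q i * _]mulrC.
congr (_ - (_ + _)); apply: eq_bigr => l _.
by rewrite sc !scalerA mulrC [b l * _]mulrC (hab l i).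
Qed.

Lemma Kn_rel0 (A : algType k) u : Kn_rel (fun=> 0 : A) (fun=> 0) u -> u = 0.
Proof.
case=> [i j|i j ij|i j ij|i j ij|i].
1-4: by rewrite mul0r scaler0 subr0.
rewrite big1 => [|l _]; last by rewrite mul0r scaler0.
by rewrite mul0r scaler0 addr0 subr0.
Qed.

End Relations.

Section KnProper.
Variables (k : fieldType) (n : nat) (p q : 'I_n -> k) (gam : 'M[k]_n).

Local Notation F := (free_alg k ('I_n + 'I_n)%type).

Definition free_x (i : 'I_n) : F := free_gen k (inl i).
Definition free_y (i : 'I_n) : F := free_gen k (inr i).

Local Notation rels := (@Kn_rel k n p q gam F free_x free_y).

Definition gens (B : Type) (x y : 'I_n -> B) (g : 'I_n + 'I_n) : B :=
  match g with inl i => x i | inr i => y i end.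

Lemma gens_rel (B : algType k) (x y : 'I_n -> B) u :
  rels u -> Kn_rel p q gam x y (free_eval (gens x y) u).
Proof.
move=> /(Kn_rel_morph (free_eval (gens x y))).
rewrite (_ : _ \o free_x = x) 1?(_ : _ \o free_y = y) //.
  by apply/funext => i /=; rewrite free_evalU.
by apply/funext => i /=; rewrite free_evalU.
Qed.

Lemma Kn_proper : ~ ideal_gen rels 1.
Proof.
move=> h1; pose phi : {lrmorphism F -> k^o} := free_eval (gens (fun=> 0) (fun=> 0)).
have /eqP : phi 1 = 0.
  by apply: (@ideal_gen_morph _ _ _ _ phi) h1 => u hu;
    exact: Kn_rel0 (@gens_rel k^o (fun=> 0) (fun=> 0) u hu).
by rewrite (rmorph1 phi) oner_eq0.
Qed.

End KnProper.

Arguments Kn_proper {k n} p q gam.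

Notation Kn p q gam := (alg_quot (Kn_proper p q gam)).

Section Kn.
Variables (k : fieldType) (n : nat) (p q : 'I_n -> k) (gam : 'M[k]_n).
Local Notation K := (Kn p q gam).
Local Notation pi := (quot_pi (Kn_proper p q gam)).

Definition Kx (i : 'I_n) : K := pi (free_x k i).
Definition Ky (i : 'I_n) : K := pi (free_y k i).

Definition KOmega (i : 'I_n) : K :=
  \sum_(l < n | (l <= i)%N) (q l - p l) *: (Ky l * Kx l).

Definition KP : set K :=
  [set a | exists i, [\/ a = Kx i, a = Ky i | a = KOmega i]].

(* Indices start at 0, so that the last clause is the one for i = 1. *)
Definition admissible (T : set K) : Prop :=
  [/\ T `<=` KP,
      forall i j : 'I_n, i = j.+1 :> nat ->
        (T (Kx i) \/ T (Ky i) <-> T (KOmega i) /\ T (KOmega j))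
    & forall i : 'I_n, i = 0%N :> nat ->
        (T (Kx i) \/ T (Ky i) <-> T (KOmega i))].

Lemma Kxy_rel v : Kn_rel p q gam Kx Ky v -> v = 0.
Proof.
move=> hv; have [u [hu ->]] :=
  @Kn_rel_morphV k n p q gam _ _ pi (@free_x k n) (@free_y k n) v hv.
exact: quot_pi_rel.
Qed.

Lemma Kn_ext (B : algType k) (phi psi : {lrmorphism K -> B}) :
  (forall i, phi (Kx i) = psi (Kx i)) -> (forall i, phi (Ky i) = psi (Ky i)) ->
  phi =1 psi.
Proof.
move=> hx hy a; have [u ->] := quot_pi_surj a.
have := free_evalE (phi \o pi) u; have := free_evalE (psi \o pi) u.
move=> /= -> ->; congr (free_eval _ u).
by apply/funext => -[] i /=; [exact: hx|exact: hy].
Qed.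

(* The point (h_1, ..., h_{2n}) of H, with tx i = h_{2i-1} and ty i = h_{2i}. *)
Record torus := Torus {
  tx : 'I_n -> k;
  ty : 'I_n -> k;
  tx_neq0 : forall i, tx i != 0;
  ty_neq0 : forall i, ty i != 0;
  torusP : forall i j, tx i * ty i = tx j * ty j }.

Definition torus_eval (h : torus) : free_alg k ('I_n + 'I_n)%type -> K :=
  free_eval (gens (fun i => tx h i *: Kx i) (fun i => ty h i *: Ky i)).
HB.instance Definition _ h := GRing.LRMorphism.on (torus_eval h).

Lemma torus_eval_rel (h : torus) u :
  Kn_rel p q gam (@free_x k n) (@free_y k n) u -> torus_eval h u = 0.
Proof.
move=> hu; have [c [v [/Kxy_rel v0 e]]] := Kn_rel_scale (torusP h)
  (@gens_rel k n p q gam K (fun i => tx h i *: Kx i) (fun i => ty h i *: Ky i)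
     u hu).
by rewrite /torus_eval e v0 scaler0.
Qed.

Definition torus_act (h : torus) : K -> K :=
  @quot_lift k _ K _ (Kn_proper p q gam) (torus_eval h) (@torus_eval_rel h).
HB.instance Definition _ h := GRing.LRMorphism.on (torus_act h).

Lemma torus_act_x h i : torus_act h (Kx i) = tx h i *: Kx i.
Proof. by rewrite /torus_act quot_liftE [LHS]free_evalU. Qed.

Lemma torus_act_y h i : torus_act h (Ky i) = ty h i *: Ky i.
Proof. by rewrite /torus_act quot_liftE [LHS]free_evalU. Qed.

Lemma torusV_proof (h : torus) :
  [/\ forall i, (tx h i)^-1 != 0, forall i, (ty h i)^-1 != 0 &
      forall i j, (tx h i)^-1 * (ty h i)^-1 = (tx h j)^-1 * (ty h j)^-1].
Proof.
split=> [i|i|i j]; rewrite ?invr_eq0 ?tx_neq0 ?ty_neq0 //.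
by rewrite -!invfM (torusP h i j).
Qed.

Definition torus_inv (h : torus) : torus :=
  let: And3 hx hy hxy := torusV_proof h in Torus hx hy hxy.

Lemma torus_actK h : cancel (torus_act h) (torus_act (torus_inv h)).
Proof.
apply: (@Kn_ext _ (torus_act (torus_inv h) \o torus_act h) idfun) => i /=.
  rewrite torus_act_x linearZ_LR /= torus_act_x scalerA /torus_inv.
  by case: torusV_proof => * /=; rewrite divff ?scale1r ?tx_neq0.
rewrite torus_act_y linearZ_LR /= torus_act_y scalerA /torus_inv.
by case: torusV_proof => * /=; rewrite divff ?scale1r ?ty_neq0.
Qed.

Lemma torus_actVK h : cancel (torus_act (torus_inv h)) (torus_act h).
Proof.
apply: (@Kn_ext _ (torus_act h \o torus_act (torus_inv h)) idfun) => i /=.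
  rewrite torus_act_x linearZ_LR /= torus_act_x scalerA /torus_inv.
  by case: torusV_proof => * /=; rewrite mulVf ?scale1r ?tx_neq0.
rewrite torus_act_y linearZ_LR /= torus_act_y scalerA /torus_inv.
by case: torusV_proof => * /=; rewrite mulVf ?scale1r ?ty_neq0.
Qed.

Lemma torus_act_bij h : bijective (torus_act h).
Proof. by exists (torus_act (torus_inv h)); [exact: torus_actK|exact: torus_actVK]. Qed.

Definition H_stable (I : set K) : Prop :=
  forall h : torus, torus_act h @` I = I.

Definition H_prime (Q : set K) : Prop :=
  [/\ is_ideal Q, Q != setT, H_stable Q &
      forall I J : set K, is_ideal I -> H_stable I -> is_ideal J -> H_stable J ->
        ideal_mul I J `<=` Q -> I `<=` Q \/ J `<=` Q].

End Kn.

(* Main.v *)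
Require Import Defs.
From mathcomp Require Import all_boot all_order all_algebra.
From mathcomp Require Import boolp classical_sets.
From mathcomp.multinomials Require Import monalg.
From mathcomp Require Import ring.

Set Implicit Arguments.
Unset Strict Implicit.
Unset Printing Implicit Defensive.

Import GRing.Theory.
Local Open Scope ring_scope.

(** The idea.  Let Q be an H-prime ideal, and let T be the set of those
distinguished elements (the x_i, y_i and Omega_i) that lie in Q.  Both the
admissibility of T and the equality of Q with the ideal generated by T come
from three facts about Kn.

- Every Omega_i commutes up to a nonzero scalar with every generator
  ([Om_gen]): Omega_i y_j is q_j y_j Omega_i if j <= i and p_j y_j Omega_i if
  j > i, and inversely for x_j.  Modulo Omega_(i-1), where Omega_0 = 0, so do
  x_i and y_i, since x_i y_i = q_i y_i x_i + Omega_(i-1).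

- An H-prime ideal is prime for products u v in which u is a torus
  eigenvector and v is normal modulo Q ([prime_cancel]).  As y_i x_i is a
  multiple of Omega_i - Omega_(i-1), this makes T admissible
  ([gen_in_Om], [Om_both_gen]).

- Kn is spanned by the monomials z^d Omega^s, with d an integer vector and s
  a vector of naturals, where z_i^m is x_i^m and z_i^(-m) is y_i^m
  ([spanned_gen]).  A product of x_i and y_i that occurs out of order is
  turned into a combination of Omega_i and Omega_(i-1).

A monomial with a factor in T lies in the ideal generated by T.  It remains to
show that the other ones, the surviving monomials, are linearly independent
modulo Q ([mon_free]); their coefficients in the expansion of an element of Q
then vanish, so that the element is in the ideal generated by T.

A single surviving monomial is not in Q ([mon_notin]): the Omegas can be
cancelled, and so can x_i if Omega_(i-1) is in Q; otherwise commuting x_i^e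
with y_i produces a nonzero multiple of x_i^(e-1) Omega_(i-1), which lowers the
degree.  Given a relation with several terms, a shorter one is obtained by
letting two linear operators that preserve Q act on it.  If two terms have
different weights, a torus element separates them ([weight_separation]); its
entries are powers of p_1 / q_1, which has infinite order.  If all weights
agree, then so do all z^d and all degrees in the Omegas, and two terms with
different s are separated by the left and the right multiplication by x_j or
y_j ([twist_separation]): they differ by a factor that records the degree in
Omega_j, ..., Omega_n, because p_j / q_j is not a root of unity. *)

(** * Induction on words and elementary facts *)

Lemma word_eval_ind (k : fieldType) (G : choiceType) (B : algType k)
    (f : G -> B) (P : B -> Prop) :
  P 1 -> (forall a b, P a -> P b -> P (a + b)) ->
  (forall c a, P a -> P (c *: a)) -> (forall g a, P a -> P (f g * a)) ->
  forall u, P (word_eval f u).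
Proof.
move=> P1 PD PZ PM u; rewrite /word_eval mmapE /=.
apply: (big_ind P) => // [|m _]; first by rewrite -(scale0r 1); exact: PZ.
rewrite -scalerAl mul1r; apply: PZ.
rewrite /mon_eval; elim: (m : seq G) => [|g s IH].
  by rewrite big_nil.
by rewrite big_cons; exact: PM.
Qed.

Lemma Kn_ind (k : fieldType) (n : nat) (p q : 'I_n -> k) (gam : 'M[k]_n)
    (P : Kn p q gam -> Prop) :
  P 1 -> (forall a b, P a -> P b -> P (a + b)) ->
  (forall c a, P a -> P (c *: a)) ->
  (forall i a, P a -> P (Kx p q gam i * a)) ->
  (forall i a, P a -> P (Ky p q gam i * a)) ->
  forall a, P a.
Proof.
move=> P1 PD PZ Px Py a; have [u ->] := quot_pi_surj a.
rewrite (free_evalE (quot_pi (Kn_proper p q gam)) u).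
by apply: word_eval_ind => // -[] i b Pb; [exact: Px|exact: Py].
Qed.

Section FreePowers.
Variable k : fieldType.

Lemma geom_neq0 (r : k) m :
  (forall l, (0 < l)%N -> r ^+ l != 1) -> \sum_(t < m.+1) r ^+ t != 0.
Proof.
move=> /(_ m.+1 isT); apply: contraNneq => r0.
by rewrite -subr_eq0 subrX1 r0 mulr0.
Qed.

Lemma exprz_free_inj (r : k) : r != 0 ->
  (forall l, (0 < l)%N -> r ^+ l != 1) -> injective (exprz r).
Proof.
move=> r0 rf a b ab; have : r ^ (a - b) = 1.
  by rewrite expfzDr // -invr_expz ab mulfV // expfz_neq0.
case e : (a - b) => [[|m]|m] /eqP; last 2 first.
- by rewrite (negPf (rf _ _)).
- by rewrite NegzE -invr_expz invr_eq1 -exprnP (negPf (rf _ _)).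
by move/eqP: e; rewrite subr_eq0 => /eqP.
Qed.

Lemma expr_free_inj (r : k) (a b : nat) : r != 0 ->
  (forall l, (0 < l)%N -> r ^+ l != 1) -> r ^+ a = r ^+ b -> a = b.
Proof.
by move=> r0 rf ab; have [] := exprz_free_inj r0 rf (ab : r ^ a = r ^ b).
Qed.

End FreePowers.

Section Ideals.
Variables (k : fieldType) (A : algType k).

Lemma idealZ (I : set A) (c : k) a : is_ideal I -> I a -> I (c *: a).
Proof. by move=> hI Ia; rewrite -mulr_algl; exact: is_idealMl. Qed.

Lemma idealB (I : set A) a b : is_ideal I -> I a -> I b -> I (a - b).
Proof.
by move=> hI Ia Ib; rewrite -scaleN1r; apply: is_idealD => //; exact: idealZ.
Qed.

Lemma idealZK (I : set A) (c : k) a : is_ideal I -> c != 0 -> I (c *: a) -> I a.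
Proof.
by move=> hI c0 /(idealZ c^-1 hI); rewrite scalerA mulVf // scale1r.
Qed.

Lemma ideal_sum (I : set A) (J : Type) (r : seq J) (P : pred J) (F : J -> A) :
  is_ideal I -> (forall i, P i -> I (F i)) -> I (\sum_(i <- r | P i) F i).
Proof. by move=> hI; apply: big_ind; [exact: is_ideal0|exact: is_idealD]. Qed.

End Ideals.

(** * Commutation up to a nonzero scalar *)

Section ScalarCommutation.
Variables (k : fieldType) (K : algType k).
Implicit Types (a b u : K).

Definition qcomm a b := exists2 c : k, c != 0 & a * b = c *: (b * a).

Lemma qcomm_sym a b : qcomm a b -> qcomm b a.
Proof.
by case=> c c0 e; exists c^-1; rewrite ?invr_eq0 // e scalerA mulVf ?scale1r.
Qed.

Lemma qcomm1 u : qcomm u 1.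
Proof. by exists 1; rewrite ?oner_neq0 // mulr1 mul1r scale1r. Qed.

Lemma qcommM u a b : qcomm u a -> qcomm u b -> qcomm u (a * b).
Proof.
move=> [c c0 ec] [d d0 ed]; exists (c * d); first by rewrite mulf_neq0.
by rewrite mulrA ec -scalerAl -[a * u * b]mulrA ed -scalerAr scalerA mulrA.
Qed.

Lemma qcommX u a m : qcomm u a -> qcomm u (a ^+ m).
Proof.
move=> ua; elim: m => [|m IH]; first exact: qcomm1.
by rewrite exprS; exact: qcommM.
Qed.

Lemma mulXr_scale a b c m : a * b = c *: (b * a) ->
  a ^+ m * b = c ^+ m *: (b * a ^+ m).
Proof.
move=> e; elim: m => [|m IH]; first by rewrite !expr0 mul1r mulr1 scale1r.
rewrite !exprS -[LHS]mulrA IH -scalerAr (mulrA a) e -scalerAl scalerA -mulrA.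
by rewrite mulrC.
Qed.

(** The error term of a q-Weyl relation accumulates as a geometric sum.  Its
ratio al * th is q_i / p_i or its inverse below, so that the coefficient does
not vanish. *)
Lemma mulXr_twist u v z (al th be : k) e :
  u * v = al *: (v * u) + be *: z -> z * u = th *: (u * z) ->
  u ^+ e.+1 * v = al ^+ e.+1 *: (v * u ^+ e.+1)
    + (be * \sum_(t < e.+1) (al * th) ^+ t) *: (u ^+ e * z).
Proof.
move=> uv zu; elim: e => [|e IH].
  by rewrite !expr1 big_ord1 /= !expr0 mulr1 mul1r.
have step : u ^+ e.+1 * v * u = al ^+ e.+1 *: (v * u ^+ e.+2)
    + (be * (\sum_(t < e.+1) (al * th) ^+ t) * th) *: (u ^+ e.+1 * z).
  rewrite IH mulrDl -!scalerAl -(mulrA v) -(exprSr u e.+1) -(mulrA (u ^+ e)) zu.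
  by rewrite -scalerAr scalerA (mulrA (u ^+ e)) -(exprSr u e).
have -> : u ^+ e.+2 * v = al *: (u ^+ e.+1 * v * u) + be *: (u ^+ e.+1 * z).
  by rewrite (exprSr u e.+1) -(mulrA _ u v) uv mulrDr -!scalerAr mulrA.
rewrite step scalerDr !scalerA -exprS -addrA -scalerDl; congr (_ + _ *: _).
rewrite [in RHS]big_ord_recl expr0 mulrDr mulr1 addrC; congr (_ + _).
under [in RHS]eq_bigr => t _ do rewrite lift0 exprS.
by rewrite -mulr_sumr -!mulrA mulrCA; congr (_ * (_ * _)); rewrite mulrC.
Qed.

Variables (n : nat) (T : Type) (g : 'I_n -> T -> K).

Definition upd (d : {ffun 'I_n -> T}) (j : 'I_n) (v : T) : {ffun 'I_n -> T} :=
  [ffun i => if i == j then v else d i].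

(** One factor of an ordered product can be varied while the factors A and B
around it stay fixed, so that reordering is only ever needed in A and B. *)
Lemma prod_frame (d : {ffun 'I_n -> T}) (j : 'I_n) : exists A B : K,
  [/\ \prod_i g i (d i) = A * g j (d j) * B,
      forall v, \prod_i g i (upd d j v i) = A * g j v * B &
      forall u, (forall i v, i != j -> qcomm u (g i v)) ->
        qcomm u A /\ qcomm u B].
Proof.
have jP : j \in index_enum 'I_n by rewrite mem_index_enum.
have := index_enum_uniq 'I_n; case/splitPr: jP => r1 r2.
rewrite cat_uniq /= negb_or => /and3P [_ /andP [jr1 _] /andP [jr2 _]].
have updE r v : j \notin r ->
    \prod_(i <- r) g i (upd d j v i) = \prod_(i <- r) g i (d i).
  move=> jr; rewrite !big_seq; apply: eq_bigr => i ir; rewrite ffunE.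
  by case: eqP ir jr => // -> ->.
exists (\prod_(i <- r1) g i (d i)), (\prod_(i <- r2) g i (d i)); split.
- by rewrite big_cat big_cons /= mulrA.
- by move=> v; rewrite big_cat big_cons /= !updE // ffunE eqxx mulrA.
move=> u hu; have aux r : j \notin r -> qcomm u (\prod_(i <- r) g i (d i)).
  move=> jr; rewrite big_seq; apply: (big_ind (qcomm u)).
  - exact: qcomm1.
  - exact: qcommM.
  by move=> i ir; apply: hu; apply: contraNneq jr => <-.
by split; apply: aux.
Qed.

Lemma qcomm_prod (d : {ffun 'I_n -> T}) u :
  (forall i v, qcomm u (g i v)) -> qcomm u (\prod_i g i (d i)).
Proof.
move=> hu; apply: (big_ind (qcomm u)) => //; [exact: qcomm1|exact: qcommM].
Qed.

End ScalarCommutation.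

(** * The elements Omega and the straightening relations *)

Section TorusPresentation.
Variables (k : fieldType) (n : nat) (p q : 'I_n -> k) (gam : 'M[k]_n).
Hypothesis p_neq0 : forall i, p i != 0.
Hypothesis q_neq0 : forall i, q i != 0.
Hypothesis p_neq_q : forall i, p i != q i.
Hypothesis gam_neq0 : forall i j, gam i j != 0.
Hypothesis gamV : forall i j, gam j i = (gam i j)^-1.
Variables (K : algType k) (x y : 'I_n -> K).
Hypothesis xy_rel : forall v, Kn_rel p q gam x y v -> v = 0.

(** The boolean selects x or y, so that statements that are symmetric in the
two are proved once. *)
Definition gen (b : bool) i := if b then x i else y i.

(** Shifted by one: [Om i.+1] is Omega_i for the index i, and [Om i] is its
predecessor, with [Om 0 = 0] for the first index. *)
Definition Om (m : nat) : K :=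
  \sum_(l < n | (l < m)%N) (q l - p l) *: (y l * x l).

Lemma gen_yy i j : y i * y j = gam i j *: (y j * y i).
Proof. by apply/eqP; rewrite -subr_eq0; apply/eqP/xy_rel; constructor. Qed.

Lemma gen_xy_lt (i j : 'I_n) : (i < j)%N ->
  x i * y j = (p j * gam j i) *: (y j * x i).
Proof.
by move=> ij; apply/eqP; rewrite -subr_eq0; apply/eqP/xy_rel; constructor.
Qed.

Lemma gen_xy_gt (i j : 'I_n) : (i > j)%N ->
  x i * y j = (q j * gam j i) *: (y j * x i).
Proof.
by move=> ij; apply/eqP; rewrite -subr_eq0; apply/eqP/xy_rel; constructor.
Qed.

Lemma gen_xx_lt (i j : 'I_n) : (i < j)%N ->
  x i * x j = (q i / p j * gam i j) *: (x j * x i).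
Proof.
by move=> ij; apply/eqP; rewrite -subr_eq0; apply/eqP/xy_rel; constructor.
Qed.

Lemma gen_xy i : x i * y i = q i *: (y i * x i) + Om i.
Proof.
by apply/eqP; rewrite -subr_eq0; apply/eqP/xy_rel; exact: Krel_xy.
Qed.

Lemma OmS (i : 'I_n) : Om i.+1 = Om i + (q i - p i) *: (y i * x i).
Proof.
rewrite /Om (bigD1 i) //= addrC; congr (_ + _); apply: eq_bigl => l.
by rewrite ltnS [RHS]ltn_neqAle andbC.
Qed.

Lemma Om0 : Om 0 = 0.
Proof. exact: big_pred0. Qed.

Lemma Om_ge m : (n <= m)%N -> Om m.+1 = Om m.
Proof.
move=> nm; apply: eq_bigl => l.
by rewrite (leq_trans (ltn_ord l) nm) (leq_trans (ltn_ord l) (leqW nm)).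
Qed.

Lemma gen_qcomm b c i j : i != j -> qcomm (gen b i) (gen c j).
Proof.
have yyq l m : qcomm (y l) (y m) by exists (gam l m) => //; exact: gen_yy.
have xxq l m : l != m -> qcomm (x l) (x m).
  rewrite neq_ltn => /orP [] lm; [|apply: qcomm_sym];
    by eexists; [|exact: gen_xx_lt]; rewrite !mulf_neq0 ?invr_eq0.
have xyq l m : l != m -> qcomm (x l) (y m).
  rewrite neq_ltn => /orP [] lm;
    by eexists; [|first [exact: gen_xy_lt|exact: gen_xy_gt]]; rewrite !mulf_neq0.
case: b; case: c => ij; [exact: xxq|exact: xyq|apply: qcomm_sym|exact: yyq].
by apply: xyq; rewrite eq_sym.
Qed.

Definition Om_scal (j : 'I_n) (m : nat) : k := if (j < m)%N then q j else p j.

Lemma Om_scal_neq0 j m : Om_scal j m != 0.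
Proof. by rewrite /Om_scal; case: ifP. Qed.

Lemma x_yx (i j : 'I_n) : i != j ->
  x j * (y i * x i) = Om_scal j i *: (y i * x i * x j).
Proof.
rewrite mulrA neq_ltn /Om_scal => /orP [] ij.
  rewrite ltnNge (ltnW ij) gen_xy_gt // -scalerAl -!mulrA (gen_xx_lt ij).
  rewrite -!scalerAr scalerA; congr (_ *: _).
  by field; rewrite p_neq0.
rewrite ij gen_xy_lt // -scalerAl -!mulrA (gen_xx_lt ij).
rewrite -!scalerAr scalerA; congr (_ *: _).
by rewrite [gam j i]gamV; field; rewrite p_neq0 gam_neq0.
Qed.

Lemma yx_y (i j : 'I_n) : i != j ->
  y i * x i * y j = Om_scal j i *: (y j * (y i * x i)).
Proof.
move=> ij; have [c [e1 e2]] : exists c, x i * y j = (c * gam j i) *: (y j * x i)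
    /\ Om_scal j i = c.
  move: ij; rewrite neq_ltn /Om_scal => /orP [] ij.
    by exists (p j); rewrite ltnNge (ltnW ij) gen_xy_lt.
  by exists (q j); rewrite ij gen_xy_gt.
by rewrite e2 -mulrA e1 -scalerAr !mulrA (gen_yy j i) -scalerAl scalerA.
Qed.

Lemma Om_scalS (i j : 'I_n) : i != j -> Om_scal j i.+1 = Om_scal j i.
Proof.
by move=> ij; rewrite /Om_scal ltnS leq_eqVlt eq_sym val_eqE (negPf ij).
Qed.

Lemma Om_scal_diag (j : 'I_n) : Om_scal j j = p j.
Proof. by rewrite /Om_scal ltnn. Qed.

(** The step m = j of the induction is the one with content: the error term
[Om j] of x_j y_j combines with p_j [Om j] to give q_j [Om j]. *)
Lemma x_Om j m : x j * Om m = Om_scal j m *: (Om m * x j).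
Proof.
elim: m => [|m IH]; first by rewrite Om0 mulr0 mul0r scaler0.
have [nm|mn] := leqP n m.
  rewrite Om_ge // IH; congr (_ *: _).
  by rewrite /Om_scal !(leq_trans (ltn_ord j)) // leqW.
pose i := Ordinal mn; rewrite -[m]/(val i) in IH *.
rewrite OmS; have [ij|ij] := eqVneq i j; last first.
  by rewrite Om_scalS // mulrDr IH mulrDl scalerDr -scalerAr x_yx // -scalerAl
    !scalerA mulrC.
rewrite -ij in IH *; rewrite mulrDr IH Om_scal_diag /Om_scal leqnn.
rewrite -scalerAr mulrA gen_xy !mulrDl !scalerDr -!scalerAl !scalerA.
rewrite addrCA -scalerDl addrC; congr (_ + _); congr (_ *: _); ring.
Qed.

Lemma Om_y j m : Om m * y j = Om_scal j m *: (y j * Om m).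
Proof.
elim: m => [|m IH]; first by rewrite Om0 mulr0 mul0r scaler0.
have [nm|mn] := leqP n m.
  rewrite Om_ge // IH; congr (_ *: _).
  by rewrite /Om_scal !(leq_trans (ltn_ord j)) // leqW.
pose i := Ordinal mn; rewrite -[m]/(val i) in IH *.
rewrite OmS; have [ij|ij] := eqVneq i j; last first.
  by rewrite Om_scalS // mulrDl IH mulrDr scalerDr -scalerAl yx_y // -scalerAr
    !scalerA mulrC.
rewrite -ij in IH *; rewrite mulrDl IH Om_scal_diag /Om_scal leqnn.
rewrite -scalerAl -mulrA gen_xy !mulrDr !scalerDr -!scalerAr !scalerA.
rewrite addrCA -scalerDl addrC; congr (_ + _); congr (_ *: _); ring.
Qed.

Definition Om_twist b j m := if b then (Om_scal j m)^-1 else Om_scal j m.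

Lemma Om_twist_neq0 b j m : Om_twist b j m != 0.
Proof. by case: b; rewrite /= ?invr_eq0 Om_scal_neq0. Qed.

Lemma Om_gen b j m : Om m * gen b j = Om_twist b j m *: (gen b j * Om m).
Proof.
case: b; last exact: Om_y.
by rewrite /= x_Om scalerA mulVf ?scale1r // Om_scal_neq0.
Qed.

Lemma Om_gen_qcomm m b j : qcomm (Om m) (gen b j).
Proof. by exists (Om_twist b j m); [exact: Om_twist_neq0|exact: Om_gen]. Qed.

(** The two scalars met when an Omega passes y_i and then x_i are inverse to
each other. *)
Lemma Om_comm m l : qcomm (Om m) (Om l).
Proof.
exists 1; rewrite ?oner_neq0 // scale1r /Om mulr_sumr mulr_suml.
apply: eq_bigr => i _; rewrite -scalerAl -scalerAr; congr (_ *: _).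
rewrite -[_ i]/(gen false i) -[x i]/(gen true i) mulrA Om_gen -scalerAl -mulrA.
rewrite Om_gen -scalerAr scalerA mulfV ?scale1r ?mulrA //.
exact: Om_scal_neq0.
Qed.

(** Both orders of the product of x_j and y_j lie in the span of two
consecutive Omegas, which is why monomials never need x_j and y_j together. *)
Lemma gen_genC b j : exists al be : k,
  gen b j * gen (~~ b) j = al *: Om j.+1 + be *: Om j.
Proof.
have qp0 : q j - p j != 0 by rewrite subr_eq0 eq_sym.
have yxE : y j * x j = (q j - p j)^-1 *: Om j.+1 - (q j - p j)^-1 *: Om j.
  by rewrite OmS scalerDr scalerA mulVf // scale1r addrC addKr.
case: b; last first.
  by exists (q j - p j)^-1, (- (q j - p j)^-1); rewrite /= yxE scaleNr.
exists (q j / (q j - p j)), (1 - q j / (q j - p j)).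
rewrite /= gen_xy yxE scalerBr !scalerA scalerBl scale1r -addrA.
by congr (_ + _); rewrite addrC.
Qed.

(** * The monomials and the elements that they span *)

Definition zpow (j : 'I_n) (d : int) : K :=
  match d with Posz m => x j ^+ m | Negz m => y j ^+ m.+1 end.

(** Every integer has this form, ambiguously so at 0; that makes either sign
available for the exponent 0. *)
Definition signed_exp (b : bool) (m : nat) : int := if b then m%:Z else - m%:Z.

Lemma signed_expP d : exists b m, d = signed_exp b m.
Proof. by case: d => m; [exists true, m|exists false, m.+1]. Qed.

Lemma zpow_exp j b m : zpow j (signed_exp b m) = gen b j ^+ m.
Proof. by case: b; case: m. Qed.

Lemma zpow_qcomm u j d : (forall b, qcomm u (gen b j)) -> qcomm u (zpow j d).
Proof.
by have [b [m ->]] := signed_expP d => uj; rewrite zpow_exp; exact: qcommX.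
Qed.

Lemma gen_zpow b j d :
  (exists m, gen b j * zpow j d = zpow j (signed_exp b m)) \/
  (exists m, zpow j d = gen (~~ b) j * zpow j (signed_exp (~~ b) m)).
Proof.
have [c [m ->]] := signed_expP d; rewrite zpow_exp.
have [->|/negPf bc] := eqVneq c b.
  by left; exists m.+1; rewrite zpow_exp exprS.
have -> : c = ~~ b by case: (b) (c) bc => -[].
case: m => [|m]; first by left; exists 1%N; rewrite expr0 mulr1 zpow_exp.
by right; exists m; rewrite zpow_exp exprS.
Qed.

Definition term : eqType := ({ffun 'I_n -> int} * {ffun 'I_n -> nat})%type.

Definition zmon (d : {ffun 'I_n -> int}) : K := \prod_i zpow i (d i).
Definition Om_mon (s : {ffun 'I_n -> nat}) : K := \prod_(i < n) Om i.+1 ^+ s i.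
Definition mon (t : term) : K := zmon t.1 * Om_mon t.2.

Lemma zmon_frame d j : exists A B : K,
  [/\ zmon d = A * zpow j (d j) * B,
      forall v, zmon (upd d j v) = A * zpow j v * B,
      forall b, qcomm (gen b j) A /\ qcomm (gen b j) B &
      forall m, qcomm (Om m) A /\ qcomm (Om m) B].
Proof.
have [A [B [e eu qc]]] := prod_frame zpow d j; exists A, B; split=> //.
  move=> b; apply: qc => i v ij; apply: zpow_qcomm => c.
  by apply: gen_qcomm; rewrite eq_sym.
by move=> m; apply: qc => i v _; apply: zpow_qcomm => c; exact: Om_gen_qcomm.
Qed.

Lemma Om_zmon_qcomm m d : qcomm (Om m) (zmon d).
Proof.
apply: (qcomm_prod (g := zpow)) => i v.
by apply: zpow_qcomm => b; exact: Om_gen_qcomm.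
Qed.

Lemma Om_Om_mon (i : 'I_n) s : exists2 c : k, c != 0 &
  Om i.+1 * Om_mon s = c *: Om_mon (upd s i (s i).+1).
Proof.
have [A [B [e eu qc]]] := prod_frame (fun (i : 'I_n) m => Om i.+1 ^+ m) s i.
have [|[c c0 ec] _] := qc (Om i.+1).
  by move=> l v _; apply: qcommX; exact: Om_comm.
exists c => //; rewrite /Om_mon e eu !mulrA ec -!scalerAl exprS.
by rewrite !mulrA.
Qed.

Definition spanned (a : K) : Prop :=
  exists L : seq (k * term), a = \sum_(e <- L) e.1 *: mon e.2.

Lemma spanned_mon t : spanned (mon t).
Proof. by exists [:: (1, t)]; rewrite big_seq1 scale1r. Qed.

Lemma spanned0 : spanned 0.
Proof. by exists [::]; rewrite big_nil. Qed.

Lemma spannedD a b : spanned a -> spanned b -> spanned (a + b).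
Proof. by move=> [L ->] [L' ->]; exists (L ++ L'); rewrite big_cat. Qed.

Lemma spannedZ c a : spanned a -> spanned (c *: a).
Proof.
move=> [L ->]; exists [seq (c * e.1, e.2) | e <- L].
by rewrite big_map scaler_sumr; apply: eq_bigr => e _; rewrite scalerA.
Qed.

Lemma spanned_Om m t : (m <= n)%N -> spanned (Om m * mon t).
Proof.
case: m => [_|m mn]; first by rewrite Om0 mul0r; exact: spanned0.
case: t => d s; have [c _ ec] := Om_zmon_qcomm m.+1 d.
have [c' _ ec'] := Om_Om_mon (Ordinal mn) s.
rewrite /mon mulrA ec -scalerAl -mulrA ec' -scalerAr scalerA.
by apply: spannedZ; exact: (spanned_mon (d, _)).
Qed.

(** Either the new generator extends the power of z_j, or it meets the opposite
generator and [gen_genC] turns the pair into Omegas, which can be moved out. *)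
Lemma spanned_gen b j t : spanned (gen b j * mon t).
Proof.
case: t => d s; have [A [B [e eu qg qO]]] := zmon_frame d j.
have [c _ ec] := (qg b).1.
have -> : gen b j * mon (d, s) =
    c *: (A * (gen b j * zpow j (d j)) * B * Om_mon s).
  by rewrite /mon e /= !mulrA ec -!scalerAl.
apply: spannedZ; have [[m ->]|[m ->]] := gen_zpow b j (d j).
  by rewrite -eu; exact: spanned_mon (_, _).
have [al [be ab]] := gen_genC b j; rewrite [gen b j * _]mulrA ab.
have aux l : (l <= n)%N ->
    spanned (A * (Om l * zpow j (signed_exp (~~ b) m)) * B * Om_mon s).
  move=> ln; have [c' _ ec'] := qcomm_sym (qO l).1.
  rewrite !mulrA ec' -!scalerAl; apply: spannedZ.
  rewrite -2!(mulrA (Om l)) -eu -mulrA.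
  exact: (spanned_Om (upd d j _, s)).
by rewrite mulrDl !(mulrDr, mulrDl) -!(scalerAl, scalerAr); apply: spannedD;
  apply/spannedZ/aux => //; exact: ltnW.
Qed.

(** Coefficients as a function on a duplicate-free list are the form needed to
speak of linear independence. *)
Lemma spanned_uniq a : spanned a -> exists (L : seq term) (c : term -> k),
  uniq L /\ a = \sum_(t <- L) c t *: mon t.
Proof.
move=> [L ->]; elim: L => [|[c0 t0] L [M [c [Mu e]]]].
  by exists [::], (fun=> 0); rewrite !big_nil.
rewrite big_cons {}e /=; have [t0M|t0M] := boolP (t0 \in M).
  exists M, (fun t => if t == t0 then c0 + c t else c t); split=> //.
  rewrite !(big_rem _ t0M) /= eqxx addrA -scalerDl; congr (_ + _).
  rewrite !big_seq; apply: eq_bigr => t; rewrite mem_rem_uniq // inE.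
  by case/andP => /negPf ->.
exists (t0 :: M), (fun t => if t == t0 then c0 else c t); split=> /=.
  by rewrite t0M.
rewrite big_cons eqxx; congr (_ + _); rewrite !big_seq; apply: eq_bigr => t.
by case: eqP t0M => // -> /negPf ->.
Qed.

(** * Torus weights and the scalars picked up by the Omegas *)

Hypothesis pq_free : forall i m, (0 < m)%N -> (p i / q i) ^+ m != 1.

Lemma qp_free i m : (0 < m)%N -> (q i / p i) ^+ m != 1.
Proof. by move=> m0; rewrite -invf_div exprVn invr_eq1 pq_free. Qed.

Variable act : torus k n -> {lrmorphism K -> K}.
Hypothesis act_x : forall h i, act h (x i) = tx h i *: x i.
Hypothesis act_y : forall h i, act h (y i) = ty h i *: y i.

(* Any index serves to name the common value of tx h i * ty h i. *)
Variable i0 : 'I_n.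

Definition Om_char (h : torus k n) := tx h i0 * ty h i0.
Definition zpow_char (h : torus k n) i (d : int) : k :=
  match d with Posz m => tx h i ^+ m | Negz m => ty h i ^+ m.+1 end.
Definition mon_char (h : torus k n) (t : term) : k :=
  (\prod_i zpow_char h i (t.1 i)) * \prod_(i < n) Om_char h ^+ t.2 i.

Lemma act_Om h m : act h (Om m) = Om_char h *: Om m.
Proof.
rewrite /Om (raddf_sum (act h)) scaler_sumr; apply: eq_bigr => l _.
rewrite /= linearZ_LR /= (rmorphM (act h)) /= act_x act_y -scalerAl -scalerAr.
rewrite !scalerA /Om_char (torusP h i0 l); congr (_ *: _); ring.
Qed.

Lemma act_mon h t : act h (mon t) = mon_char h t *: mon t.
Proof.
rewrite (rmorphM (act h)) !(rmorph_prod (act h)) /mon_char -scalerA.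
rewrite [in RHS]/mon scalerAr scalerAl -!scaler_prod.
congr (_ * _); apply: eq_bigr => i _.
  by case: (t.1 i) => m; rewrite /= (rmorphXn (act h)) /= ?act_x ?act_y exprZn.
by rewrite /= (rmorphXn (act h)) /= act_Om exprZn.
Qed.

(** The torus element scaling only x_i and y_i, inversely to each other,
detects d_i; the one scaling all y_i alike detects, for equal d, the degree in
the Omegas. *)
Lemma weight_separation (t t' : term) :
  t.1 <> t'.1 \/ (\sum_i t.2 i <> \sum_i t'.2 i)%N ->
  exists h, mon_char h t != mon_char h t'.
Proof.
set r := p i0 / q i0; have r0 : r != 0 by rewrite mulf_neq0 ?invr_eq0.
have [dd /=|] := eqVneq t.1 t'.1; last first.
  move=> dd _; have [i di] : exists i, t.1 i != t'.1 i.
    apply/existsP; rewrite -negb_forall; apply: contra dd => /forallP e.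
    by apply/eqP/ffunP => i; apply/eqP.
  pose hx (l : 'I_n) : k := if l == i then r else 1.
  have hx0 l : hx l != 0 by rewrite /hx; case: ifP; rewrite ?oner_neq0.
  have hy0 l : (hx l)^-1 != 0 by rewrite invr_eq0.
  have hh l l' : hx l * (hx l)^-1 = hx l' * (hx l')^-1 by rewrite !mulfV.
  exists (Torus hx0 hy0 hh); set h := Torus _ _ _.
  have charE u : mon_char h u = r ^ (u.1 i).
    rewrite /mon_char [X in _ * X]big1 => [|l _]; last first.
      by rewrite /Om_char /= mulfV // expr1n.
    rewrite mulr1 (bigD1 i) //= big1 => [|l /negPf li]; last first.
      by rewrite /zpow_char /= /hx li invr1; case: (u.1 l) => m; rewrite expr1n.
    rewrite mulr1 /zpow_char /= /hx eqxx.
    by case: (u.1 i) => m //; rewrite exprVn.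
  rewrite !charE; apply: contra di => /eqP/(exprz_free_inj r0 (pq_free i0)) ->.
  exact: eqxx.
case=> // ss.
pose hx (l : 'I_n) : k := 1; pose hy (l : 'I_n) : k := r.
have hx0 l : hx l != 0 by exact: oner_neq0.
have hh l l' : hx l * hy l = hx l' * hy l' by [].
exists (Torus hx0 (fun=> r0) hh); set h := Torus _ _ _.
have charE u : mon_char h u =
    (\prod_i zpow_char h i (u.1 i)) * r ^+ (\sum_i u.2 i)%N.
  rewrite /mon_char -prodrXr; congr (_ * _).
  by apply: eq_bigr => i _; rewrite /Om_char /= mul1r.
rewrite !charE dd; apply/eqP => e; apply: ss.
have z0 : \prod_i zpow_char h i (t'.1 i) != 0.
  apply/prodf_neq0 => i _; rewrite /zpow_char.
  by case: (t'.1 i) => m; rewrite /= expf_neq0 // oner_neq0.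
exact: expr_free_inj r0 (pq_free i0) (mulfI z0 e).
Qed.

Definition Om_mon_twist b j (s : {ffun 'I_n -> nat}) : k :=
  \prod_(i < n) Om_twist b j i.+1 ^+ s i.

Lemma Om_mon_gen b j s :
  Om_mon s * gen b j = Om_mon_twist b j s *: (gen b j * Om_mon s).
Proof.
rewrite /Om_mon /Om_mon_twist; elim: (index_enum _) => [|i r IH].
  by rewrite !big_nil mul1r mulr1 scale1r.
rewrite !big_cons -[LHS]mulrA IH -scalerAr (mulrA _ (gen b j)).
by rewrite (mulXr_scale _ (Om_gen b j i.+1)) -scalerAl scalerA -mulrA mulrC.
Qed.

(** Take j to be the last index at which s and s' differ: for equal total
degrees, the scalar of y_j only depends on the sum of the s_i with i >= j, and
these sums differ by s_j - s'_j. *)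
Lemma twist_separation (s s' : {ffun 'I_n -> nat}) :
  s <> s' -> (\sum_i s i = \sum_i s' i)%N ->
  exists j, (s j <> 0 \/ s' j <> 0)%N /\
    forall b, Om_mon_twist b j s != Om_mon_twist b j s'.
Proof.
move=> ss sum; have [i /= di] : exists i, s i != s' i.
  apply/existsP; rewrite -negb_forall; apply: contra_notN ss => /forallP e.
  by apply/ffunP => i; apply/eqP.
case: (@arg_maxnP _ i (fun l => s l != s' l) val di) => j dj jmax {i di}.
exists j; split.
  by case: (s j) (s' j) dj => [|a] [|b] //; [right|left|left].
set r := q j / p j; have r0 : r != 0 by rewrite mulf_neq0 ?invr_eq0.
have twE u : Om_mon_twist false j u =
    p j ^+ (\sum_i u i)%N * r ^+ (\sum_(i < n | (j <= i)%N) u i)%N.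
  rewrite -!prodrXr [X in _ * X]big_mkcond -big_split /=.
  apply: eq_bigr => i _; rewrite /Om_twist /Om_scal ltnS /r.
  by case: ifP => _; rewrite ?mulr1 // -exprMn mulrCA mulfV ?mulr1.
have tw : Om_mon_twist false j s != Om_mon_twist false j s'.
  rewrite !twE sum; apply: contra dj => /eqP/(mulfI (expf_neq0 _ (p_neq0 j))) e.
  have := expr_free_inj r0 (qp_free j) e.
  rewrite (bigD1 j) // [X in _ = X](bigD1 j) //=.
  rewrite (eq_bigr s') => [/addIn -> //|i /andP [ji ij]].
  apply/eqP; apply: contraNT ij => /jmax /= ij.
  by rewrite -val_eqE eqn_leq ji andbT.
case=> //; have twV u : Om_mon_twist true j u = (Om_mon_twist false j u)^-1.
  by rewrite -prodfV; apply: eq_bigr => i _; rewrite exprVn.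
by rewrite !twV (inj_eq invr_inj).
Qed.

(** With the sign of the exponent d_j, or any sign if d_j = 0, the generator
extends z^d from both sides to the same monomial. *)
Lemma zmon_extend (d : {ffun 'I_n -> int}) j : exists b m,
  [/\ d j = signed_exp b m,
      exists2 c : k, c != 0 &
        gen b j * zmon d = c *: zmon (upd d j (signed_exp b m.+1)) &
      exists2 c : k, c != 0 &
        zmon d * gen b j = c *: zmon (upd d j (signed_exp b m.+1))].
Proof.
have [b [m dj]] := signed_expP (d j); exists b, m.
have [A [B [e eu qg _]]] := zmon_frame d j; split=> //.
  have [c c0 ec] := (qg b).1; exists c => //.
  by rewrite eu e dj !zpow_exp !mulrA ec -!scalerAl exprS !mulrA.
have [c c0 ec] := qcomm_sym (qg b).2; exists c => //.
by rewrite eu e dj !zpow_exp -!mulrA ec -!scalerAr exprSr !mulrA.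
Qed.

(** * Cancellation modulo an H-prime ideal *)

Definition eigenvector (a : K) : Prop :=
  forall h, exists2 c : k, c != 0 & act h a = c *: a.

Lemma eigenvectorM a b : eigenvector a -> eigenvector b -> eigenvector (a * b).
Proof.
move=> ea eb h; have [c c0 ec] := ea h; have [c' c'0 ec'] := eb h.
exists (c * c'); first by rewrite mulf_neq0.
by rewrite (rmorphM (act h)) /= ec ec' -scalerAl -scalerAr scalerA.
Qed.

Lemma eigenvector1 : eigenvector 1.
Proof.
by move=> h; exists 1; rewrite ?oner_neq0 // (rmorph1 (act h)) scale1r.
Qed.

Lemma eigenvector_gen b i : eigenvector (gen b i).
Proof.
by case: b => h; [exists (tx h i)|exists (ty h i)];
  rewrite ?act_x ?act_y ?tx_neq0 ?ty_neq0.
Qed.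

Lemma eigenvector_Om m : eigenvector (Om m).
Proof.
move=> h; exists (Om_char h); last exact: act_Om.
by rewrite mulf_neq0 ?tx_neq0 ?ty_neq0.
Qed.

Lemma eigenvectorX a m : eigenvector a -> eigenvector (a ^+ m).
Proof.
move=> ea; elim: m => [|m IH]; first exact: eigenvector1.
by rewrite exprS; exact: eigenvectorM.
Qed.

Lemma eigenvector_zmon d : eigenvector (zmon d).
Proof.
apply: big_ind; [exact: eigenvector1|exact: eigenvectorM|move=> i _].
have [b [m ->]] := signed_expP (d i); rewrite zpow_exp.
exact/eigenvectorX/eigenvector_gen.
Qed.

Hypothesis K_ind : forall P : K -> Prop,
  P 1 -> (forall a b, P a -> P b -> P (a + b)) ->
  (forall c a, P a -> P (c *: a)) -> (forall b i a, P a -> P (gen b i * a)) ->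
  forall a, P a.

Variable Q : set K.
Hypothesis Q_ideal : is_ideal Q.
Hypothesis Q_proper : ~ Q 1.
Hypothesis Q_stable : forall h a, Q a -> Q (act h a).
Hypothesis Q_prime : forall u v, eigenvector u ->
  (forall r, Q (u * r * v)) -> Q u \/ Q v.

(** If v moves to the left past every r modulo Q, then u v in Q puts all of u K v
into Q, where primeness applies. *)
Definition normal_mod (v : K) : Prop := forall r, exists r', Q (r * v - v * r').

Lemma normal_mod_gen v :
  (forall b i, exists c : k, Q (gen b i * v - c *: (v * gen b i))) ->
  normal_mod v.
Proof.
move=> hv; apply: K_ind => [|a b [a' ha] [b' hb]|c a [a' ha]|b i a [a' ha]].
- by exists 1; rewrite mul1r mulr1 subrr; exact: is_ideal0.
- exists (a' + b'); rewrite mulrDl mulrDr opprD addrACA; exact: is_idealD.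
- by exists (c *: a'); rewrite -scalerAl -scalerAr -scalerBr; exact: idealZ.
have [c hc] := hv b i; exists (c *: (gen b i * a')).
have -> : gen b i * a * v - v * (c *: (gen b i * a')) =
    gen b i * (a * v - v * a') + (gen b i * v - c *: (v * gen b i)) * a'.
  rewrite mulrBr mulrBl !mulrA addrA subrK; congr (_ - _).
  by rewrite -scalerAr -scalerAl mulrA.
by apply: is_idealD => //; [exact: is_idealMl|exact: is_idealMr].
Qed.

Lemma prime_cancel u v : eigenvector u -> normal_mod v ->
  Q (u * v) -> Q u \/ Q v.
Proof.
move=> eu nv uv; apply: Q_prime => // r; have [r' hr] := nv r.
have -> : u * r * v = u * (r * v - v * r') + u * v * r'.
  by rewrite mulrBr !mulrA subrK.
by apply: is_idealD => //; [exact: is_idealMl|exact: is_idealMr].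
Qed.

Lemma normal_Om m : normal_mod (Om m).
Proof.
apply: normal_mod_gen => b i; have [c _ e] := qcomm_sym (Om_gen_qcomm m b i).
by exists c; rewrite e subrr; exact: is_ideal0.
Qed.

Lemma cancel_Om u m : eigenvector u -> ~ Q (Om m) -> Q (u * Om m) -> Q u.
Proof. by move=> eu nO /(prime_cancel eu (normal_Om m)) []. Qed.

Lemma gen_gen_twist b (j : 'I_n) : exists al be : k, [/\ be != 0,
  gen b j * gen (~~ b) j = al *: (gen (~~ b) j * gen b j) + be *: Om j &
  forall m, (0 < m)%N -> (al * Om_twist b j j) ^+ m != 1].
Proof.
case: b; rewrite /Om_twist Om_scal_diag /=.
  exists (q j), 1; split; rewrite ?oner_neq0 //; last exact: qp_free.
  by rewrite scale1r; exact: gen_xy.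
exists (q j)^-1, (- (q j)^-1); split; rewrite ?oppr_eq0 ?invr_eq0 //.
  by rewrite gen_xy scalerDr scalerA mulVf // scale1r scaleNr addrK.
by move=> m m0; rewrite mulrC; exact: pq_free.
Qed.

(** Modulo [Om j], the error term of x_j y_j vanishes. *)
Lemma normal_gen b (j : 'I_n) : Q (Om j) -> normal_mod (gen b j).
Proof.
move=> QO; apply: normal_mod_gen => c i.
have [->|ij] := eqVneq i j; last first.
  have [a _ e] := gen_qcomm c b ij.
  by exists a; rewrite e subrr; exact: is_ideal0.
have [->|/negPf cb] := eqVneq c b.
  by exists 1; rewrite scale1r subrr; exact: is_ideal0.
have -> : b = ~~ c by case: (b) (c) cb => -[].
have [al [be [_ -> _]]] := gen_gen_twist c j; exists al.
by rewrite addrC addKr; exact: idealZ.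
Qed.

Definition survives_z (d : {ffun 'I_n -> int}) : Prop :=
  forall j b m, d j = signed_exp b m.+1 -> ~ Q (gen b j).

Lemma signed_exp_sign b m b' m' : signed_exp b m.+1 = signed_exp b' m' -> b = b'.
Proof. by case: b b' m' => -[] []. Qed.

Lemma signed_exp_abs b m : absz (signed_exp b m) = m.
Proof. by case: b; rewrite /signed_exp ?abszN. Qed.

Lemma survives_z_upd d j b m : survives_z d -> ~ Q (gen b j) ->
  survives_z (upd d j (signed_exp b m)).
Proof.
move=> gd nQ i c l; rewrite ffunE; case: eqP => [->|_]; last exact: gd.
by move/esym/signed_exp_sign => ->.
Qed.

(** Induction on the total degree.  A generator with [Om j] in Q is normal
modulo Q and can be cancelled.  Otherwise both products with the opposite generator are in
Q, and the error term of their twisted commutator is the monomial of smaller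
degree times [Om j]. *)
Lemma zmon_notin d : survives_z d -> ~ Q (zmon d).
Proof.
have [N] := ubnP (\sum_j absz (d j)); elim: N d => // N IH d.
have [j dj|d0 _ _] := pickP (fun j => d j != 0); last first.
  by rewrite /zmon big1 // => i _; move/eqP: (d0 i) => ->.
have [b [[|m] ej]] := signed_expP (d j); first by
  rewrite ej /signed_exp oppr0 if_same in dj.
move=> dN gd Qd; have nQ := gd _ _ _ ej.
have [A [B [e eu qg qO]]] := zmon_frame d j.
pose d' := upd d j (signed_exp b m).
suff Qd' : Q (zmon d').
  apply: (IH d') Qd'; last exact: survives_z_upd.
  move: dN; rewrite (bigD1 j) //= [X in _ -> (X < _)%N](bigD1 j) //=.
  rewrite ffunE eqxx ej !signed_exp_abs.
  rewrite [X in _ -> (_ + X < _)%N](eq_bigr (fun i => absz (d i))) // => i.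
  by rewrite ffunE => /negPf ->.
have ed' : zmon d' = A * gen b j ^+ m * B by rewrite eu zpow_exp.
rewrite e ej zpow_exp in Qd.
have [QO|nO] := pselect (Q (Om j)).
  suff Qg : Q (zmon d' * gen b j).
    by case: (prime_cancel (eigenvector_zmon d') (normal_gen b QO) Qg).
  have [c c0 ec] := qcomm_sym (qg b).2.
  rewrite ed' -mulrA ec -scalerAr; apply: idealZ => //.
  by rewrite mulrA -(mulrA A) -exprSr.
apply: (cancel_Om (eigenvector_zmon d') nO).
have [al [be [be0 gg free]]] := gen_gen_twist b j.
(* The generator power g^(m+1) inside z^d is commuted with the opposite one. *)
have key := mulXr_twist m gg (Om_gen b j j).
set c := be * _ in key.
have c0 : c != 0 by rewrite mulf_neq0 // geom_neq0.
have [cB cB0 eB] := qcomm_sym (qO j).2.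
rewrite ed' -mulrA eB -scalerAr; apply: idealZ => //.
apply: (idealZK Q_ideal c0).
have -> : c *: (A * gen b j ^+ m * (Om j * B)) =
    A * (gen b j ^+ m.+1 * gen (~~ b) j) * B -
    al ^+ m.+1 *: (A * (gen (~~ b) j * gen b j ^+ m.+1) * B).
  rewrite key mulrDr mulrDl -!scalerAr -!scalerAl addrC addKr.
  by rewrite !mulrA.
apply: idealB => //.
  have := is_idealMr Q_ideal (gen (~~ b) j) Qd.
  rewrite -(mulrA _ B); have [c'' c''0 ->] := qcomm_sym (qg (~~ b)).2.
  by rewrite -scalerAr !mulrA; exact: idealZK.
apply: idealZ => //; have := is_idealMl Q_ideal (gen (~~ b) j) Qd.
rewrite !mulrA; have [c'' c''0 ->] := (qg (~~ b)).1.
by rewrite -!scalerAl; exact: idealZK.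
Qed.

Definition survives (t : term) : Prop :=
  survives_z t.1 /\ forall i, t.2 i <> 0%N -> ~ Q (Om i.+1).

Lemma mon_notin t : survives t -> ~ Q (mon t).
Proof.
case: t => d s [gd gs] /= Qt; apply: (zmon_notin gd).
move: (eigenvector_zmon d) Qt; rewrite /mon /Om_mon /= => ed.
move: ed; elim: (index_enum _) (zmon d) => [|i r IH] u eu.
  by rewrite big_nil mulr1.
have eX m : eigenvector (u * Om i.+1 ^+ m).
  by apply/eigenvectorM/eigenvectorX/eigenvector_Om.
rewrite big_cons mulrA => /(IH _ (eX _)).
have [-> |/gs nO] := pselect (s i = 0%N); first by rewrite mulr1.
elim: (s i) => [|m IHm]; first by rewrite mulr1.
by rewrite exprSr mulrA => /(cancel_Om (eX m) nO).
Qed.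

(** * Linear independence modulo the ideal *)

Lemma gen_in_Om b (j : 'I_n) : Q (gen b j) -> Q (Om j) /\ Q (Om j.+1).
Proof.
move=> Qg; have [Qxy Qyx] : Q (x j * y j) /\ Q (y j * x j).
  by case: b Qg => /= Qg; split; try exact: is_idealMr; exact: is_idealMl.
have QOj : Q (Om j).
  have -> : Om j = x j * y j - q j *: (y j * x j) by rewrite gen_xy addrC addKr.
  by apply: idealB => //; exact: idealZ.
by split=> //; rewrite OmS; apply: is_idealD => //; exact: idealZ.
Qed.

(** Induction on the number of terms.  The reindexing phi lets multiplication by
a generator change the monomials while the coefficients, whose vanishing is
at stake, remain indexed by the same list. *)
Lemma mon_free (L : seq term) (phi : term -> term) (c : term -> k) :
  uniq L -> {in L &, injective phi} -> {in L, forall t, survives (phi t)} ->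
  Q (\sum_(t <- L) c t *: mon (phi t)) -> {in L, forall t, c t = 0}.
Proof.
have [N] := ubnP (size L); elim: N L phi c => // N IH [|t0 L] // phi c LN.
move=> Lu phi_inj phi_surv QL.
have t0L := mem_head t0 L; have sub t : t \in L -> t \in t0 :: L.
  by move=> tL; rewrite inE tL orbT.
(* One vanishing coefficient suffices: its term can be dropped. *)
have elim0 t1 : t1 \in t0 :: L -> c t1 = 0 -> {in t0 :: L, forall t, c t = 0}.
  move=> t1L c1 t tL; have [-> //|tt1] := eqVneq t t1.
  have rsub u : u \in rem t1 (t0 :: L) -> u \in t0 :: L by exact: mem_rem.
  apply: (IH (rem t1 (t0 :: L)) phi c).
  - by rewrite size_rem.
  - exact: rem_uniq.
  - by move=> u v /rsub uL /rsub vL; exact: phi_inj.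
  - by move=> u /rsub; exact: phi_surv.
  - by move: QL; rewrite (big_rem _ t1L) /= c1 scale0r add0r.
  by rewrite mem_rem_uniq // inE tt1.
(* A second relation with coefficients scaled by kap eliminates t0 from the
   first one without killing t1, if kap separates them. *)
have separated t1 psi kap : t1 \in L -> {in t0 :: L &, injective psi} ->
    {in t0 :: L, forall t, survives (psi t)} -> kap t1 != kap t0 ->
    Q (\sum_(t <- t0 :: L) c t *: mon (psi t)) ->
    Q (\sum_(t <- t0 :: L) (kap t * c t) *: mon (psi t)) ->
    {in t0 :: L, forall t, c t = 0}.
  move=> t1L psi_inj psi_surv kt Q1 Q2; apply: (elim0 t1); first exact: sub.
  have : (kap t1 - kap t0) * c t1 = 0.
    apply: (IH L psi (fun t => (kap t - kap t0) * c t)) (t1) (t1L) => //.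
    - by case/andP: Lu.
    - by move=> u v /sub uL /sub vL; exact: psi_inj.
    - by move=> u /sub; exact: psi_surv.
    have := idealB Q_ideal Q2 (idealZ (kap t0) Q_ideal Q1).
    rewrite scaler_sumr -sumrB big_cons scalerA subrr add0r.
    rewrite (eq_bigr (fun t => ((kap t - kap t0) * c t) *: mon (psi t))) //.
    by move=> t _; rewrite scalerA -scalerBl mulrBl.
  by move/eqP; rewrite mulf_eq0 subr_eq0 (negPf kt) => /eqP.
pose deg t := (\sum_i (phi t).2 i)%N.
have [same|] := pselect
  {in L, forall t, (phi t).1 = (phi t0).1 /\ deg t = deg t0}; last first.
  move=> diff; have [t1 [t1L dt]] : exists t, t \in L /\
      ((phi t).1 <> (phi t0).1 \/ deg t <> deg t0).
    apply: contrapT => none; apply: diff => t tL.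
    by split; apply: contrapT => ne; apply: none; exists t; auto.
  have [h ht] := weight_separation dt.
  apply: (separated t1 phi (fun t => mon_char h (phi t))) => //.
  have := Q_stable h QL; rewrite (raddf_sum (act h)) /=.
  rewrite (eq_bigr (fun t => (mon_char h (phi t) * c t) *: mon (phi t))) //.
  by move=> t _; rewrite linearZ_LR /= act_mon scalerA mulrC.
case: L => [|t1 L] in LN Lu phi_inj phi_surv QL t0L sub elim0 separated same *.
  move=> t; rewrite inE => /eqP ->; apply: contrapT => /eqP c0.
  rewrite big_seq1 in QL; apply: (mon_notin (phi_surv t0 t0L)).
  exact: idealZK QL.
have t1L := mem_head t1 L; have [e1 e2] := same _ t1L.
have [||j [js twj]] := @twist_separation (phi t1).2 (phi t0).2 => //.
  move=> e; have : t1 = t0.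
    apply: phi_inj => //; first exact: sub.
    by move: e1 e; case: (phi t1) (phi t0) => ?? [??] /= -> ->.
  by move=> E; move: Lu; rewrite E /= inE eqxx.
set d := (phi t0).1 in same e1.
have same1 t : t \in [:: t0, t1 & L] -> (phi t).1 = d.
  by rewrite inE => /predU1P [->|/same []].
have [b [m [dj [al al0 eal] [be be0 ebe]]]] := zmon_extend d j.
set d' := upd d j _ in eal ebe.
have nO : ~ Q (Om j.+1).
  case: js => js; first exact: (phi_surv t1 (sub _ t1L)).2 js.
  exact: (phi_surv t0 t0L).2 js.
(* As Omega_j is not in Q, neither x_j nor y_j is, so the extended monomials
   still survive whichever of the two is used. *)
have nOgen c' : ~ Q (gen c' j) by move=> /gen_in_Om [_ /nO].
pose psi t : term := (d', (phi t).2).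
apply: (separated t1 psi (fun t => Om_mon_twist b j (phi t).2)) => //.
- move=> u v uL vL [e]; apply: phi_inj => //.
  move: (same1 _ uL) (same1 _ vL) e.
  by case: (phi u) (phi v) => ?? [??] /= -> -> ->.
- move=> u uL; split; last exact: (phi_surv u uL).2.
  by apply: survives_z_upd => //; exact: (phi_surv t0 t0L).1.
- apply: (idealZK Q_ideal al0).
  have := is_idealMl Q_ideal (gen b j) QL; rewrite mulr_sumr scaler_sumr.
  rewrite big_seq [X in _ -> Q X]big_seq.
  rewrite (eq_bigr (fun t => al *: (c t *: mon (psi t)))) // => t tL.
  rewrite -scalerAr /mon (same1 _ tL) mulrA eal -scalerAl !scalerA.
  by rewrite mulrC.
apply: (idealZK Q_ideal be0).
have := is_idealMr Q_ideal (gen b j) QL; rewrite mulr_suml scaler_sumr.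
rewrite big_seq [X in _ -> Q X]big_seq.
rewrite (eq_bigr (fun t =>
  be *: ((Om_mon_twist b j (phi t).2 * c t) *: mon (psi t)))) // => t tL.
rewrite -scalerAl /mon (same1 _ tL) -mulrA Om_mon_gen -scalerAr mulrA ebe.
by rewrite -scalerAl !scalerA; congr (_ *: _); ring.
Qed.

(** Q is contained in every ideal between the one generated by the distinguished
elements of Q and Q itself. *)
Lemma prime_sub_ideal (I : set K) : is_ideal I ->
  (forall a, I a -> Q a) ->
  (forall b i, Q (gen b i) -> I (gen b i)) ->
  (forall i : 'I_n, Q (Om i.+1) -> I (Om i.+1)) ->
  forall a, Q a -> I a.
Proof.
move=> I_ideal IQ Igen IOm a Qa.
have bad t : ~ survives t -> I (mon t).
  case: t => d s nt; have [gd|/existsNP [j]] := pselect (survives_z d);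
    last first.
    move=> /existsNP [b /existsNP [m /not_implyP [dj /contrapT /Igen Ig]]].
    have [A [B [e _ _ _]]] := zmon_frame d j.
    rewrite /mon /= e dj zpow_exp exprS; do 2! apply: is_idealMr => //.
    by apply: is_idealMl => //; exact: is_idealMr.
  have [i [si /IOm Ii]] : exists i, s i <> 0%N /\ Q (Om i.+1).
    apply: contrapT => none; apply: nt; split=> // i si Qi.
    by apply: none; exists i.
  have [A [B [e _ _]]] := prod_frame (fun (i : 'I_n) m => Om i.+1 ^+ m) s i.
  rewrite /mon /Om_mon /= e; apply: is_idealMl => //; apply: is_idealMr => //.
  apply: is_idealMl => //; case: (s i) si => // m _.
  by rewrite exprS; exact: is_idealMr.
have [L [c [Lu ea]]] : exists (L : seq term) (c : term -> k),
    uniq L /\ a = \sum_(t <- L) c t *: mon t.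
  apply: spanned_uniq; elim/K_ind: a {Qa} => [|||b i a [L ->]].
  - have -> : 1 = mon ([ffun=> 0], [ffun=> 0%N]).
      by rewrite /mon /zmon /Om_mon !big1 ?mulr1 // => i _; rewrite ffunE.
    exact: spanned_mon.
  - exact: spannedD.
  - exact: spannedZ.
  rewrite mulr_sumr; apply: (big_ind spanned) => [||[c t] _].
  - exact: spanned0.
  - exact: spannedD.
  by rewrite -scalerAr; apply: spannedZ; exact: spanned_gen.
pose g t := `[< survives t >].
have Ibad : I (\sum_(t <- L | ~~ g t) c t *: mon t).
  by apply: ideal_sum => // t /asboolPn /bad Im; exact: idealZ.
move: ea; rewrite (bigID g) /=; set a1 := \sum_(_ <- _ | g _) _ => ea.
have Qa1 : Q a1.
  by have := idealB Q_ideal Qa (IQ _ Ibad); rewrite ea addrK.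
rewrite ea; apply: is_idealD => //.
rewrite /a1 -big_filter in Qa1 *.
rewrite big_seq big1 => [|t tL]; first exact: is_ideal0.
rewrite (mon_free (phi := id) _ _ _ Qa1 tL) ?scale0r ?filter_uniq //.
by move=> u; rewrite mem_filter => /andP [/asboolP].
Qed.

(** The product y_j x_j is a multiple of the difference of the two Omegas, and
x_j is normal modulo the first. *)
Lemma Om_both_gen (j : 'I_n) : Q (Om j) -> Q (Om j.+1) -> Q (x j) \/ Q (y j).
Proof.
move=> QO QO'; apply/or_comm.
apply: (prime_cancel (eigenvector_gen false j) (normal_gen true QO)).
have qp0 : q j - p j != 0 by rewrite subr_eq0 eq_sym.
apply: (idealZK Q_ideal qp0).
by have := idealB Q_ideal QO' QO; rewrite OmS addrC addKr.
Qed.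

End TorusPresentation.

(** * H-prime ideals and the theorem *)

Section Kn.
Variables (k : fieldType) (n : nat) (p q : 'I_n -> k) (gam : 'M[k]_n).
Local Notation K := (Kn p q gam).

Definition torus_lrmorphism (h : torus k n) : {lrmorphism K -> K} :=
  @torus_act k n p q gam h.

Lemma H_stableP (I : set K) :
  H_stable I <-> forall h a, I a -> I (torus_act h a).
Proof.
split=> [hI h a Ia|hI h]; first by rewrite -(hI h); exists a.
apply/seteqP; split=> [_ [a Ia <-]|a Ia]; first exact: hI.
by exists (torus_act (torus_inv h) a); [exact: hI|exact: torus_actVK].
Qed.

(** The ideals to which H-primeness is applied are annihilators modulo Q rather
than generated ideals: J consists of the b with u K b in Q, which is H-stable
because u is an eigenvector, and I is the left annihilator of J. *)
Lemma H_prime_elements (Q : set K) (u v : K) : H_prime Q ->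
  eigenvector torus_lrmorphism u -> (forall r, Q (u * r * v)) -> Q u \/ Q v.
Proof.
move=> [Qi _ /H_stableP Qst Qpr] eu huv.
pose J : set K := [set b | forall r, Q (u * r * b)]%classic.
pose I : set K := [set a | forall b, J b -> Q (a * b)]%classic.
have Ji : is_ideal J.
  split=> [r|a b ha hb r|a b hb r|a b hb r].
  - by rewrite mulr0; exact: is_ideal0.
  - by rewrite mulrDr; exact: is_idealD.
  - by rewrite mulrA -(mulrA u); exact: hb.
  - by rewrite mulrA; exact: is_idealMr.
have Jst : H_stable J.
  apply/H_stableP => h b Jb r; have [c c0 ec] := eu h.
  apply: (idealZK Qi c0).
  have := Qst h _ (Jb (torus_act (torus_inv h) r)).
  rewrite !(rmorphM (torus_lrmorphism h)) /=.
  rewrite -[torus_lrmorphism h u]/(torus_act h u).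
  by rewrite [torus_act h u]ec torus_actVK -!scalerAl.
have Ii : is_ideal I.
  split=> [b Jb|a a' ha ha' b Jb|a a' ha' b Jb|a a' ha' b Jb].
  - by rewrite mul0r; exact: is_ideal0.
  - by rewrite mulrDl; apply: is_idealD => //; [exact: ha|exact: ha'].
  - by rewrite -mulrA; apply: is_idealMl => //; exact: ha'.
  - by rewrite -mulrA; apply: ha'; exact: (is_idealMl Ji).
have Ist : H_stable I.
  apply/H_stableP => h a Ia b Jb; rewrite -(torus_actVK h b).
  rewrite -(rmorphM (torus_lrmorphism h)); apply: Qst; apply: Ia.
  by move/H_stableP: Jst; apply.
have [|sub|sub] := Qpr I J Ii Ist Ji Jst.
- move=> _ [s [hs ->]]; rewrite big_seq; apply: ideal_sum => // ab /hs [Ia Jb].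
  exact: Ia.
- by left; apply: sub => b Jb; have := Jb 1; rewrite mulr1.
- by right; apply: sub => r; exact: huv.
Qed.

End Kn.

Theorem theorem3p8 (k : fieldType) (n : nat) (n_ge1 : (1 <= n)%N)
  (p q : 'I_n -> k) (gam : 'M[k]_n)
  (p_neq0 : forall i, p i != 0) (q_neq0 : forall i, q i != 0)
  (p_neq_q : forall i, p i != q i)
  (gam_neq0 : forall i j, gam i j != 0)
  (gamV : forall i j, gam j i = (gam i j)^-1)
  (gam_diag : forall i, gam i i = 1)
  (pq_not_root_of_unity :
     forall (i : 'I_n) (m : nat), (0 < m)%N -> ~~ m.-unity_root (p i / q i))
  (Q : set (Kn p q gam)) (Q_prime : H_prime Q) :
  exists T : set (Kn p q gam), admissible T /\ Q = ideal_gen T.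
Proof.
have [Q_ideal Q_neqT /H_stableP Q_stable _] := Q_prime.
have Q1 : ~ Q 1.
  move=> Q1; move/eqP: Q_neqT; apply; apply/seteqP; split=> // a _.
  by rewrite -[a]mulr1; exact: is_idealMl.
have pq_free i m : (0 < m)%N -> (p i / q i) ^+ m != 1.
  by move=> m0; rewrite -unity_rootE; exact: pq_not_root_of_unity.
set x := Kx p q gam; set y := Ky p q gam.
have rel : forall v, Kn_rel p q gam x y v -> v = 0 by exact: Kxy_rel.
have ind (P : Kn p q gam -> Prop) : P 1 ->
    (forall a b, P a -> P b -> P (a + b)) -> (forall c a, P a -> P (c *: a)) ->
    (forall b i a, P a -> P (gen x y b i * a)) -> forall a, P a.
  move=> P1 PD PZ Pg; apply: Kn_ind => // i a; first exact: (Pg true).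
  exact: (Pg false).
have prime_el := H_prime_elements Q_prime.
have gen_Om b i := @gen_in_Om k n p q gam _ x y rel Q Q_ideal b i.
have Om_gen (i : 'I_n) := Om_both_gen p_neq0 q_neq0 p_neq_q gam_neq0 rel pq_free
  (@torus_act_x k n p q gam) (@torus_act_y k n p q gam) ind Q_ideal prime_el
  (j := i).
pose T : set (Kn p q gam) := [set a | KP a /\ Q a]%classic.
have Tx i : T (x i) <-> Q (x i).
  by split=> [[]//|Qx]; split=> //; exists i; constructor 1.
have Ty i : T (y i) <-> Q (y i).
  by split=> [[]//|Qy]; split=> //; exists i; constructor 2.
have TO i : T (KOmega p q gam i) <-> Q (Om p q x y i.+1).
  by split=> [[]//|QO]; split=> //; exists i; constructor 3.
have Txy i : T (x i) \/ T (y i) <-> Q (Om p q x y i) /\ Q (Om p q x y i.+1).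
  split=> [[/Tx|/Ty]|[QO QO']].
  - exact: (gen_Om true).
  - exact: (gen_Om false).
  - by case: (Om_gen i QO QO') => [/Tx|/Ty]; [left|right].
exists T; split.
  split=> [a []//|i j ij|i i0].
    split=> [/Txy [QO QO']|[/TO QO' /TO QO]].
      by split; apply/TO => //; rewrite -ij.
    by apply/Txy; rewrite ij in QO' *.
  split=> [/Txy [_ /TO]//|/TO QO']; apply/Txy; split=> //.
  by rewrite i0 Om0; exact: is_ideal0.
apply/seteqP; split=> [a|a Ta]; last by apply: (Ta Q); split=> // b [].
have subT := @sub_ideal_gen _ T.
apply: (prime_sub_ideal p_neq0 q_neq0 p_neq_q gam_neq0 gamV rel pq_free
  (@torus_act_x k n p q gam) (@torus_act_y k n p q gam) (Ordinal n_ge1) ind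
  Q_ideal Q1 Q_stable prime_el).
- exact: ideal_gen_ideal.
- by move=> b Tb; apply: (Tb Q); split=> // c [].
- by case=> i Qg; apply: subT; [exact/Tx|exact/Ty].
- by move=> i QO; apply: subT; exact/TO.
Qed.
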